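(* Let $\mathbf{k}=(k_f)_{f\in\Lambda}\in\mathbb{N}_0^{\sharp\Lambda}$. For every $\mathbf{y}\in V\setminus\bigcup_{f\in\widetilde{\Lambda}\cap\Lambda_1}(\mathfrak{H}_{\Lambda\setminus\{f\}}+\mathbb{Z}^r)$ the limit $$S(\mathbf{k},\mathbf{y};\Lambda)=\lim_{N\to\infty}Z(N;\mathbf{k},\mathbf{y};\Lambda)$$ exists, and $S(\mathbf{k},\mathbf{y};\Lambda)$ is continuous in $\mathbf{y}$ on $V\setminus\bigcup_{f\in\widetilde{\Lambda}\cap\Lambda_1}(\mathfrak{H}_{\Lambda\setminus\{f\}}+\mathbb{Z}^r)$.
   Context: Fix an integer $r\ge1$ and let $V=\mathbb{R}^r$ with the standard inner product $\langle\cdot,\cdot\rangle$. An element $f=(\vec f,b_f)\in V\times\mathbb{C}$ is regarded as the affine functional $f(\mathbf{v})=\langle\vec f,\mathbf{v}\rangle+b_f$ on $V$. Let $\Lambda\subset(\mathbb{Z}^r\setminus\{0\})\times\mathbb{C}$ be a finite set such that the $\mathbb{Z}$-module generated by $\vec\Lambda=\{\vec f: f\in\Lambda\}$ has rank $r$. Let $\widetilde\Lambda=\{f\in\Lambda:\ \text{the $\mathbb{Z}$-module generated by }\vec\Lambda\setminus\{\vec f\}\text{ has rank}\neq r\}$. For $H\subset\Lambda$ whose vectors generate a module of rank $r-1$, let $\mathfrak{H}_H=\sum_{g\in H}\mathbb{R}\vec g$ (a hyperplane). To each $f\in\Lambda$ attach $k_f\in\mathbb{N}_0$ ($\mathbb{N}_0=\{0,1,2,\dots\}$),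 and put $\Lambda_k=\{f\in\Lambda: k_f=k\}$, $\Lambda_+=\{f\in\Lambda:k_f>0\}$. For $N>0$ and $\mathbf{y}\in V$ define $$Z(N;\mathbf{k},\mathbf{y};\Lambda)=(-1)^{\sharp\Lambda_0}\sum_{\substack{\mathbf{v}=(v_1,\dots,v_r)\in\mathbb{Z}^r,\ |v_j|\le N\ (1\le j\le r)\\ f(\mathbf{v})\neq0\ (f\in\Lambda_+),\ f(\mathbf{v})=0\ (f\in\Lambda_0)}} e^{2\pi\sqrt{-1}\langle\mathbf{y},\mathbf{v}\rangle}\prod_{f\in\Lambda_+}\frac{1}{f(\mathbf{v})^{k_f}}.$$ *)

(* Defs.v *)
From HB Require Import structures.
From mathcomp Require Import all_boot all_order all_algebra.
From mathcomp Require Import finmap complex.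
From mathcomp Require Import all_classical all_reals all_analysis.

Set Implicit Arguments.
Unset Strict Implicit.
Unset Printing Implicit Defensive.

Import Order.TTheory GRing.Theory Num.Theory.
Import numFieldNormedType.Exports.

Local Open Scope classical_set_scope.
Local Open Scope ring_scope.
Local Open Scope complex_scope.

Section ZModuleRank.
Variable V : zmodType.

Definition Zspan (A : {fset V}) : set V :=
  [set v | inIntSpan (in_tuple (enum_fset A)) v].

Definition Zfree (n : nat) (s : n.-tuple V) : Prop :=
  forall a : 'I_n -> int,
    \sum_(i < n) tnth s i *~ a i = 0 -> forall i, a i = 0.

(* [Zrank M n]: the Z-module M has rank n, i.e. n is the largest size of a
   Z-linearly independent family of elements of M. *)
Definition Zrank (M : set V) (n : nat) : Prop :=
  (exists s : n.-tuple V, (forall i, M (tnth s i)) /\ Zfree s) /\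
  (forall (m : nat) (s : m.-tuple V),
     (forall i, M (tnth s i)) -> Zfree s -> (m <= n)%N).

End ZModuleRank.

Section LatticeSums.
Variables (R : realType) (r : nat).

Local Notation V := 'rV[R]_r.
(* The functional f = (vec f, b_f), with integral linear part. *)
Local Notation func := ('rV[int]_r * R[i])%type.

Definition ofZ (v : 'rV[int]_r) : V := map_mx intr v.

Definition dot (u v : V) : R := \sum_(j < r) u 0 j * v 0 j.

Definition feval (f : func) (v : V) : R[i] := (dot (ofZ f.1) v)%:C + f.2.

Definition cexp (z : R[i]) : R[i] :=
  (expR (complex.Re z))%:C * (cos (complex.Im z) +i* sin (complex.Im z)).

Definition vecs (L : {fset func}) : {fset 'rV[int]_r} := [fset f.1 | f in L]%fset.

(* All occurrences of the vector of f are removed from the set [vecs L],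
   including those coming from other elements of L. *)
Definition Ltilde (L : {fset func}) : set func :=
  [set f | f \in L /\ ~ Zrank (Zspan (vecs L `\ f.1)%fset) r].

Definition Lk (L : {fset func}) (k : func -> nat) (m : nat) : {fset func} :=
  [fset f in L | k f == m]%fset.

Definition Lplus (L : {fset func}) (k : func -> nat) : {fset func} :=
  [fset f in L | (0 < k f)%N]%fset.

Definition hyp (H : {fset func}) : {vspace V} :=
  <<[seq ofZ g | g <- enum_fset (vecs H)]>>%VS.

Definition hypZ (H : {fset func}) : set V :=
  [set h + ofZ m | h in [set h : V | h \in hyp H] & m in [set: 'rV[int]_r]].

Definition ydom (L : {fset func}) (k : func -> nat) : set V :=
  ~` \bigcup_(f in Ltilde L `&` [set f | f \in Lk L k 1]) hypZ (L `\ f)%fset.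

Definition box (N : R) (L : {fset func}) (k : func -> nat) : set 'rV[int]_r :=
  [set v : 'rV[int]_r | [/\ forall j, `|(v 0 j)%:~R : R| <= N,
               forall f, f \in Lplus L k -> feval f (ofZ v) != 0
             & forall f, f \in Lk L k 0 -> feval f (ofZ v) = 0]].

(* The index set is finite, so the finitely supported sum is the full sum.
   R[i]^o is R[i] with the topology of its modulus. *)
Definition Zsum (N : R) (k : func -> nat) (y : V) (L : {fset func}) : R[i]^o :=
  ((-1) ^+ #|` Lk L k 0| *
  \sum_(v \in box N L k)
    (cexp (0 +i* (2 * pi * dot y (ofZ v))) *
     \prod_(f <- enum_fset (Lplus L k)) (feval f (ofZ v) ^+ k f)^-1) : R[i]).

Definition Slim (k : func -> nat) (y : V) (L : {fset func}) : R[i]^o :=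
  lim (Zsum N k y L @[N --> +oo%R]).

End LatticeSums.

(* Main.v *)
Require Import Defs.
From HB Require Import structures.
From mathcomp Require Import all_boot all_order all_algebra.
From mathcomp Require Import finmap complex zify ring lra.
From mathcomp Require Import all_classical all_reals all_analysis.

(** Write each summand as a product of factors depending only on the integers
[<f, v>]; a factor is [O((1 + |<f, v>|) ^ - kap f)] with [kap f = 1] if
[k f = 1] and [kap f = 2] otherwise.  Such a product is absolutely summable over
[Z^r] as soon as every [f] with [kap f = 1] can be removed without lowering the
rank: at each [v] the factor of the largest functional is redistributed over a
basis avoiding it, and the change of variables given by the basis splits the sum
into one-dimensional convergent sums.  For the remaining [f] (coloops with
[k f = 1]) there is a primitive integral vector [e] orthogonal to the other
functionals; summation by parts along [e] multiplies the partial sum by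
[1 - exp (2 pi i <y, e>)], replaces the factor of [f] by its difference, which
decays quadratically, and costs a boundary sum of size [O(n ^ (-1/2))] uniformly
in [y].  Hence the partial sums times the product [P y] of the numbers
[1 - exp (2 pi i <y, e>)] converge uniformly on the whole of [V], and [P y]
vanishes nowhere on the given domain. *)

Set Implicit Arguments.
Unset Strict Implicit.
Unset Printing Implicit Defensive.

Import Order.TTheory GRing.Theory Num.Theory.
Import numFieldNormedType.Exports.

Local Open Scope classical_set_scope.
Local Open Scope ring_scope.
Local Open Scope complex_scope.

(** * Integral vectors: orthogonality, bases and primitivity *)

Definition idot {r : nat} (u v : 'rV[int]_r) : int := \sum_j u 0 j * v 0 j.

Lemma idotE (r : nat) (u v : 'rV[int]_r) : idot u v = (u *m v^T) 0 0.
Proof. by rewrite mxE; apply: eq_bigr => j _; rewrite mxE. Qed.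

Lemma idotDr (r : nat) (u v w : 'rV[int]_r) :
  idot u (v + w) = idot u v + idot u w.
Proof. by rewrite !idotE linearD mulmxDr mxE. Qed.

Lemma idotNr (r : nat) (u v : 'rV[int]_r) : idot u (- v) = - idot u v.
Proof. by rewrite !idotE linearN mulmxN mxE. Qed.

Lemma idotZr (r : nat) (a : int) (u v : 'rV[int]_r) :
  idot u (a *: v) = a * idot u v.
Proof. by rewrite !idotE linearZ /= -scalemxAr mxE. Qed.

Definition vecmx {r : nat} {T : Type} (vec : T -> 'rV[int]_r)
    (i0 : 'I_r -> T) : 'M[int]_r := \matrix_(i, j) vec (i0 i) 0 j.

(* If the Gram matrix of [s] is singular, an integral kernel vector is
   orthogonal to all of [s], since it is isotropic for a sum of squares. *)
Lemma basis_or_orthogonal (r : nat) (T : eqType) (vec : T -> 'rV[int]_r)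
    (s : seq T) :
  (exists2 b : 'I_r -> T, forall i, b i \in s & \det (vecmx vec b) != 0) \/
  (exists2 e : 'rV[int]_r, e != 0 & forall f, f \in s -> idot (vec f) e = 0).
Proof.
pose M : 'M[int]_(size s, r) := \matrix_(i, j) vec (tnth (in_tuple s) i) 0 j.
have [/eqP/det0P [u u0 uM]|detM] := eqVneq (\det (M^T *m M)) 0.
  right; exists u => // f fs.
  have z0 : u *m M^T = 0.
    have : (u *m M^T *m (u *m M^T)^T) 0 0 = 0.
      by rewrite trmx_mul trmxK !mulmxA -(mulmxA u) uM mul0mx mxE.
    rewrite mxE => /eqP; rewrite psumr_eq0 => [/allP z0|i _]; last first.
      by rewrite [X in _ * X]mxE -expr2 sqr_ge0.
    apply/rowP => i; have := z0 i (mem_index_enum _).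
    by rewrite [X in _ * X]mxE -expr2 sqrf_eq0 => /eqP ->; rewrite mxE.
  have fi : (index f s < size s)%N by rewrite index_mem.
  have := congr1 (fun w : 'rV_ _ => w 0 (Ordinal fi)) z0.
  rewrite !mxE => <-; apply: eq_bigr => j _; rewrite !mxE mulrC.
  by rewrite (tnth_nth f) /= nth_index.
left; pose A := map_mx (intr : int -> rat) M.
have fA : row_full A.
  rewrite -col_leq_rank; apply: leq_trans (mxrankM_maxr A^T A).
  rewrite mxrank_unit //.
  by rewrite /A map_trmx -map_mxM unitmxE unitfE det_map_mx intr_eq0.
exists (fun i => tnth (in_tuple s) (fullrankfun fA i)).
  by move=> i; exact: mem_tnth.
have := fullrowsub_unit fA.
rewrite unitmxE unitfE; apply: contraNN => /eqP d0.
rewrite (_ : rowsub _ A = map_mx intr (vecmx vec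
   (fun i => tnth (in_tuple s) (fullrankfun fA i)))).
  by rewrite det_map_mx d0.
by apply/matrixP => i j; rewrite !mxE.
Qed.

(** A free family of [r] vectors in the span forms a square matrix [S] that kills [e]. Were [e]
    nonzero, [S] would be singular, and an integral left kernel vector would be a relation in the
    free family. *)
Lemma Zrank_orthogonal0 (r : nat) (A : {fset 'rV[int]_r}) (e : 'rV[int]_r) :
  Zrank (Zspan A) r -> (forall a, a \in A -> idot a e = 0) -> e = 0.
Proof.
move=> [[s [sA fs]] _] eA; apply/eqP/negPn/negP => e0.
pose S : 'M[int]_r := \matrix_(i, j) tnth s i 0 j.
have Se : S *m e^T = 0.
  apply/colP => i.
  have -> : (S *m e^T) i 0 = idot (tnth s i) e.
    by rewrite mxE; apply: eq_bigr => j _; rewrite !mxE.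
  have [a ->] := sA i.
  rewrite idotE mulmx_suml summxE big1 ?mxE // => k _.
  rewrite -scaler_int -scalemxAl mxE -idotE eA ?mulr0 //.
  by apply: mem_nth.
have : \det S^T = 0 by apply/eqP/det0P; exists e; rewrite // -[LHS]trmxK trmx_mul trmxK Se trmx0.
rewrite det_tr => /eqP/det0P[u u0 uS].
case/eqP: u0; apply/rowP => i; rewrite mxE.
apply: (fs (fun i => u 0 i)); apply/rowP => j.
have := congr1 (fun w : 'rV_ _ => w 0 j) uS; rewrite !mxE => <-.
rewrite summxE; apply: eq_bigr => k _.
by rewrite -scaler_int !mxE intz.
Qed.

(** The least positive value [g] of [idot e] divides every coordinate of [e], since a nonzero
    remainder would be a smaller positive value. Dividing by [g] gives [e'], and a point where [g]
    is attained serves as [m]. *)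
Lemma primitive_multiple (r : nat) (e : 'rV[int]_r) : e != 0 ->
  exists e' m : 'rV[int]_r, exists2 g : int, g != 0 & e = g *: e' /\ idot e' m = 1.
Proof.
move=> e0.
pose P := fun n : nat => (0 < n)%N && `[< exists m : 'rV[int]_r, idot e m = n%:Z >].
have exP : exists n, P n.
  have [j ej] : exists j, e 0 j != 0.
    apply/existsP; rewrite -negb_forall; apply: contra e0 => /forallP ej.
    by apply/eqP/rowP => j; rewrite mxE; exact/eqP.
  exists (absz (e 0 j)); rewrite /P absz_gt0 ej /=; apply/asboolP.
  exists (sgz (e 0 j) *: delta_mx 0 j).
  rewrite idotZr /idot (bigD1 j) //= big1 ?addr0.
    by rewrite mxE !eqxx mulr1; case: (sgzP (e 0 j)) => [x0|x0|x0]; lia.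
  by move=> k /negbTE kj; rewrite mxE eqxx kj mulr0.
case: (ex_minnP exP) => g /andP[g0 /asboolP[m em]] gmin.
have gdvd j : (g%:Z %| e 0%R j)%Z.
  apply/dvdz_mod0P/eqP/negPn/negP => rem0.
  set q := (e 0%R j %/ g)%Z; set t := (e 0%R j %% g)%Z in rem0 *.
  have t0 : 0 <= t by rewrite modz_ge0 // -lt0n.
  have tg : t < g%:Z by rewrite ltz_mod // -lt0n.
  have : P (absz t).
    rewrite /P absz_gt0 rem0 /=; apply/asboolP.
    exists (delta_mx 0 j - q *: m).
    rewrite idotDr idotNr idotZr em gez0_abs //.
    rewrite /idot (bigD1 j) //= big1 ?addr0.
      by rewrite mxE !eqxx mulr1 /t /modz.
    by move=> k /negbTE kj; rewrite mxE eqxx kj mulr0.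
  move/gmin; lia.
exists (\row_j (e 0%R j %/ g)%Z), m, g%:Z; first by rewrite -lt0n.
have ee : e = g%:Z *: \row_j (e 0%R j %/ g)%Z.
  by apply/rowP => j; rewrite !mxE mulrC divzK.
split => //; apply: (@mulfI _ g%:Z); first by rewrite -lt0n.
transitivity (idot e m); last by rewrite mulr1.
rewrite [in RHS]ee /idot mulr_sumr; apply: eq_bigr => j _.
by rewrite !mxE mulrA.
Qed.

(** * Sums over cubes of lattice points and integral changes of variables *)

Definition cube (r n : nat) : seq 'rV[int]_r :=
  [seq \row_j ((f j : nat)%:Z - n%:Z) | f : {ffun 'I_r -> 'I_n.*2.+1}].

Lemma cube_uniq (r n : nat) : uniq (cube r n).
Proof.
rewrite map_inj_uniq ?enum_uniq // => f g /rowP fg; apply/ffunP => j.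
by apply/val_inj; move: (fg j); rewrite !mxE => /addIr [].
Qed.

Lemma mem_cube (r n : nat) (v : 'rV[int]_r) :
  (v \in cube r n) = [forall j, leq (absz (v 0%R j)) n].
Proof.
apply/mapP/forallP => [[f _ ->] j|vn].
  by rewrite mxE; case: (f j) => k kn /=; lia.
exists [ffun j => inord (absz (v 0 j + n%:Z))]; rewrite ?mem_enum //.
apply/rowP => j; rewrite mxE ffunE; have := vn j.
by move: (v 0 j) => z zn; rewrite inordK; lia.
Qed.

Lemma sum_cube_prod (K : comPzRingType) (r n : nat) (g : 'I_r -> int -> K) :
  \sum_(v <- cube r n) \prod_i g i (v 0 i) =
  \prod_i \sum_(m < n.*2.+1) g i ((m : nat)%:Z - n%:Z).
Proof.
rewrite bigA_distr_bigA /= big_map big_enum /=; apply: eq_bigr => f _.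
by apply: eq_bigr => i _; rewrite mxE.
Qed.

(** Each absolute value is taken at most twice: the indices [m < n] and [m >= n] are each compared
    with one copy of the sum. *)
Lemma sum_absz_le (K : numDomainType) (n : nat) (h : nat -> K) :
  (forall k, 0 <= h k) ->
  \sum_(m < n.*2.+1) h (absz ((m : nat)%:Z - n%:Z)) <= 2 * \sum_(k < n.+1) h k.
Proof.
move=> h0; rewrite -(big_mkord xpredT (fun m => h (absz (m%:Z - n%:Z)))).
rewrite (@big_cat_nat _ _ _ n) //=; last by lia.
rewrite mulr_natl mulr2n lerD //.
  rewrite big_nat_rev /= add0n -(big_mkord xpredT h) big_nat_recl //=.
  rewrite ler_wpDl // big_nat [leRHS]big_nat.
  apply: ler_sum => i /= ni.
  by rewrite le_eqVlt; apply/orP; left; apply/eqP; congr h; lia.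
rewrite -{1}[n]add0n big_addn (_ : (n.*2.+1 - n)%N = n.+1); last by lia.
by rewrite big_mkord; apply: ler_sum => i _; rewrite le_eqVlt; apply/orP; left; apply/eqP; congr h; lia.
Qed.

Lemma ler_sum_uniq_sub (K : numDomainType) (T : eqType) (s t : seq T)
    (F : T -> K) : uniq s -> uniq t -> {subset s <= t} ->
  (forall x, 0 <= F x) -> \sum_(x <- s) F x <= \sum_(x <- t) F x.
Proof.
move=> us ut st F0.
rewrite [leRHS](bigID (mem s)) /= -[\sum_(i <- t | i \in s) _]big_filter.
have ps : perm_eq [seq x <- t | x \in s] s.
  apply: uniq_perm; rewrite ?filter_uniq // => x; rewrite mem_filter.
  by apply: andb_idr => /st.
by rewrite (perm_big _ ps) ler_wpDr // sumr_ge0.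
Qed.

Definition mxbound {r : nat} (B : 'M[int]_r) : nat := \sum_i \sum_j absz (B i j).

Lemma row_idot_bound (r n : nat) (B : 'M[int]_r) (v : 'rV[int]_r) (i : 'I_r) :
  v \in cube r n -> (absz (idot (row i B) v) <= mxbound B * n)%N.
Proof.
rewrite mem_cube => /forallP vn.
have vs : (absz (idot (row i B) v) <= \sum_j absz (B i j * v 0%R j)%R)%N.
  rewrite /idot; elim/big_ind2 : _ => //= [a x b y ax byy|j _]; first by lia.
  by rewrite mxE.
apply: (leq_trans vs).
rewrite /mxbound big_distrl /= [X in (_ <= X)%N](bigD1 i) //=.
apply: (leq_trans _ (leq_addr _ _)).
by rewrite big_distrl /=; apply: leq_sum => j _; rewrite abszM leq_mul.
Qed.

(* [v |-> B v] is injective, so the sum is dominated by one over a cube of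
   coordinates, where it factors. *)
Lemma sum_prod_le (K : numDomainType) (r n : nat) (B : 'M[int]_r)
    (h : 'I_r -> nat -> K) :
  \det B != 0 -> (forall i k, 0 <= h i k) ->
  \sum_(v <- cube r n) \prod_i h i (absz (idot (row i B) v)) <=
  \prod_i (2 * \sum_(k < (mxbound B * n).+1) h i k).
Proof.
move=> dB h0.
pose w (v : 'rV[int]_r) : 'rV[int]_r := v *m B^T.
have wE v i : w v 0 i = idot (row i B) v.
  by rewrite mxE; apply: eq_bigr => j _; rewrite !mxE mulrC.
have winj : injective w.
  move=> u v /(congr1 (mulmx^~ (\adj B^T))).
  rewrite /w -!mulmxA mul_mx_adj !mul_mx_scalar det_tr.
  move=> /rowP uv; apply/rowP => i; apply: (mulfI dB).
  by move: (uv i); rewrite !mxE.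
apply: (@le_trans _ _ (\sum_(v <- cube r (mxbound B * n)) \prod_i h i (absz (v 0 i)))).
  under eq_bigr => v _ do under eq_bigr => i _ do rewrite -wE.
  rewrite -(big_map w xpredT (fun u => \prod_i h i (absz (u 0 i)))).
  apply: ler_sum_uniq_sub; rewrite ?(map_inj_uniq winj) ?cube_uniq //.
    move=> _ /mapP[v vn ->]; rewrite mem_cube; apply/forallP => i.
    by rewrite wE row_idot_bound.
  by move=> v; rewrite prodr_ge0.
rewrite (sum_cube_prod _ (fun i m => h i (absz m))).
apply: ler_prod => i _; rewrite sumr_ge0 //=; exact: sum_absz_le.
Qed.

(** * One-dimensional weights and their sums *)

Section Weights.
Variable R : realType.

Definition wt (n : nat) : R := n.+1%:R^-1.

Definition rt (p n : nat) : R := n.+1%:R `^ p%:R^-1.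

Lemma wt_gt0 (n : nat) : 0 < wt n.
Proof. by rewrite invr_gt0 ltr0n. Qed.

Lemma wt_ge0 (n : nat) : 0 <= wt n.
Proof. exact/ltW/wt_gt0. Qed.

Lemma wt_le1 (n : nat) : wt n <= 1.
Proof. by rewrite invf_le1 ?ltr0n // ler1n. Qed.

Lemma rt_gt0 (p n : nat) : 0 < rt p n.
Proof. by rewrite /rt powR_gt0 ?ltr0n. Qed.

Lemma rt_pow (p n : nat) : (0 < p)%N -> rt p n ^+ p = n.+1%:R.
Proof.
move=> p0; rewrite /rt -powR_mulrn ?powR_ge0 // -powRrM mulVf ?pnatr_eq0 -?lt0n //.
by rewrite powRr1 // ler0n.
Qed.

Lemma rt_ge1 (p n : nat) : 1 <= rt p n.
Proof.
have {1}<- : (1 : R) `^ p%:R^-1 = 1 by rewrite powR1.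
rewrite /rt ge0_ler_powR ?invr_ge0 ?ler0n ?nnegrE //.
by rewrite ler1n.
Qed.

Lemma le_rt (p m n : nat) : (m <= n)%N -> rt p m <= rt p n.
Proof.
by move=> mn; rewrite /rt ge0_ler_powR ?invr_ge0 ?ler0n ?nnegrE // ler_nat.
Qed.

(** This is [(n + 1) ^ (- 1 - 1 / p)]: the weight [wt] improved by just enough to be summable. *)
Definition rho (p n : nat) : R := wt n / rt p n.

Lemma rho_ge0 (p n : nat) : 0 <= rho p n.
Proof. by rewrite divr_ge0 ?wt_ge0 // ltW ?rt_gt0. Qed.

(* Telescoping: with [a ^ p = n + 1] and [b ^ p = n + 2] the mean value bound
   [1 <= p (b - a) b ^ (p - 1)] gives [rho (n + 1) <= p (1 / a - 1 / b)]. *)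
Lemma sum_rho_le (p n : nat) : (0 < p)%N -> \sum_(k < n) rho p k <= p.+1%:R.
Proof.
move=> p0; case: n => [|n]; first by rewrite big_ord0 ler0n.
suff : \sum_(k < n.+1) rho p k <= p.+1%:R - p%:R / rt p n.
  move=> /le_trans; apply; rewrite gerBl divr_ge0 ?ler0n // ltW ?rt_gt0 //.
elim: n => [|n IHn].
  rewrite big_ord_recl big_ord0 addr0 /rho /wt /rt powR1 !divr1 invr1.
  by rewrite -natr1 addrAC subrr add0r.
rewrite big_ord_recr /=; apply: le_trans (lerD IHn (lexx _)) _.
rewrite -addrA lerD2l addrC lerBlDr addrC lerBrDr.
have a1 := rt_ge1 p n; have a0 := rt_gt0 p n; have b0 := rt_gt0 p n.+1.
have ab : rt p n <= rt p n.+1 by rewrite le_rt.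
have ap := rt_pow n p0; have bp := rt_pow n.+1 p0.
rewrite /rho /wt -bp; move: (rt p n) (rt p n.+1) ap bp a1 a0 b0 ab => a b.
move=> ap bp a1 a0 b0 ab.
have h1 : 1 <= p%:R * (b - a) * b ^+ p.-1.
  have e1 : b ^+ p - a ^+ p = 1 by rewrite ap bp -[in X in X - _]natr1 addrAC subrr add0r.
  rewrite -[leLHS]e1 subrXX -mulrA mulrCA ler_wpM2l ?subr_ge0 //.
  apply: (@le_trans _ _ (\sum_(i < p) b ^+ p.-1)); last first.
    by rewrite sumr_const card_ord mulr_natl.
  apply: ler_sum => i _; have ip := ltn_ord i.
  have -> : b ^+ p.-1 = b ^+ (p.-1 - i) * b ^+ i by rewrite -exprD subnK //; lia.
  by rewrite ler_wpM2l ?exprn_ge0 ?lerXn2r ?nnegrE // ltW.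
have h2 : a <= p%:R * (b - a) * b ^+ p.
  rewrite -(prednK p0) exprSr mulrA; apply: (le_trans ab).
  by rewrite -[leLHS]mul1r ler_wpM2r ?(prednK p0) // ltW.
have -> : p%:R / a = (p%:R * (b - a) * b ^+ p) / (a * b * b ^+ p) + p%:R / b.
  by field; rewrite ?expf_neq0 ?gt_eqF.
rewrite lerD2r -invfM -[leLHS]mul1r.
have -> : 1 / (b ^+ p * b) = a / (a * b * b ^+ p) by field; rewrite ?expf_neq0 ?gt_eqF.
by rewrite ler_wpM2r // invr_ge0 !mulr_ge0 ?exprn_ge0 // ltW.
Qed.

(** A substitute for logarithmic growth, with an arbitrarily small power: [wt k] is
    [rho p k * rt p k], the root is largest at the end of the range, and the [rho p k] have bounded
    sums. *)
Lemma sum_wt_le (p n : nat) : (0 < p)%N ->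
  \sum_(k < n.+1) wt k <= p.+1%:R * rt p n.
Proof.
move=> p0; apply: (@le_trans _ _ (\sum_(k < n.+1) rho p k * rt p n)).
  apply: ler_sum => k _; have kn := ltn_ord k.
  rewrite /rho -mulrA ler_peMr ?wt_ge0 //.
  by rewrite mulrC ler_pdivlMr ?rt_gt0 // mul1r le_rt.
by rewrite -mulr_suml ler_wpM2r ?sum_rho_le // ltW ?rt_gt0.
Qed.

(** The indicator selects the [k] within distance [K] of [n]; they all lie in
    [iota (n - K) K.*2.+1], even when the subtraction is truncated. *)
Lemma sum_window_le (n K M : nat) :
  \sum_(k < M) ((n <= k + K) && (k <= n + K))%N%:R <= (K.*2.+1)%:R :> R.
Proof.
pose P k := ((n <= k + K) && (k <= n + K))%N.
have -> : \sum_(k < M) (P k)%:R = (count P (iota 0 M))%:R :> R.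
  rewrite -(big_mkord xpredT (fun k => (P k)%:R : R)) -natr_sum -sum1_count.
  rewrite [in RHS]big_mkcond /= /index_iota subn0.
  apply: (congr1 (fun m : nat => m%:R)).
  by apply: eq_bigr => k _; case: (P k).
rewrite ler_nat -size_filter -(size_iota (n - K) K.*2.+1).
apply: uniq_leq_size; first by rewrite filter_uniq ?iota_uniq.
by move=> k; rewrite mem_filter !mem_iota /P; lia.
Qed.
End Weights.

(** * Exchanging a functional for a coordinate; estimates near the boundary of the cube *)

Definition setrow {r : nat} (B : 'M[int]_r) (i j : 'I_r) : 'M[int]_r :=
  \matrix_(k, l) (if k == i then (l == j)%:R else B k l).

(** Row [i] has become a unit vector, so Laplace expansion along it leaves one cofactor, which
    involves only the untouched rows. Hence the exchanged matrix is nonsingular exactly when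
    [\adj B j i] is nonzero. *)
Lemma det_setrow (r : nat) (B : 'M[int]_r) (i j : 'I_r) :
  \det (setrow B i j) = \adj B j i.
Proof.
rewrite (expand_det_row _ i) (bigD1 j) //= big1 => [|l /negbTE lj]; last first.
  by rewrite mxE eqxx lj mul0r.
rewrite addr0 !mxE !eqxx mul1r; congr (_ * \det _).
by apply/matrixP => k l; rewrite !mxE eq_sym (negbTE (neq_lift _ _)).
Qed.

Lemma idot_row_setrow (r : nat) (B : 'M[int]_r) (i j k : 'I_r) (v : 'rV[int]_r) :
  idot (row k (setrow B i j)) v = if k == i then v 0 j else idot (row k B) v.
Proof.
case: eqP => [->|/eqP/negbTE ki].
  rewrite /idot (bigD1 j) //= big1 => [|l /negbTE lj]; last first.
    by rewrite !mxE eqxx lj mul0r.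
  by rewrite !mxE !eqxx mul1r addr0.
by apply: eq_bigr => l _; rewrite !mxE ki.
Qed.

(** Cramer's rule: [\det B * v 0 j] is a combination of the values [idot (row i B) v] with
    coefficients [\adj B j i], and a nonzero integral determinant has absolute value at least
    [1]. *)
Lemma coord_le_adj (r : nat) (B : 'M[int]_r) (v : 'rV[int]_r) (j : 'I_r) :
  \det B != 0 ->
  ((absz (v ord0 j)).+1 <=
   \sum_(i | \adj B j i != 0%R) absz (\adj B j i) * (absz (idot (row i B) v)).+1)%N.
Proof.
move=> dB.
have adjv : \det B * v 0 j = \sum_i \adj B j i * idot (row i B) v.
  have := congr1 (fun M : 'M[int]_r => (M *m v^T) j 0) (mul_adj_mx B).
  rewrite mul_scalar_mx -mulmxA => /esym; rewrite !mxE => ->.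
  apply: eq_bigr => i _; congr (_ * _).
  by rewrite mxE; apply: eq_bigr => l _; rewrite !mxE.
(* Some coefficient is nonzero, as otherwise a diagonal entry of [\adj B *m B] would vanish; it
   absorbs the successor on the left. *)
have [i adji] : exists i, \adj B j i != 0.
  apply/existsP; rewrite -negb_forall; apply: contra dB => /forallP a0.
  have := congr1 (fun M : 'M[int]_r => M j j) (mul_adj_mx B).
  rewrite !mxE eqxx mulr1n => <-; rewrite big1 // => l _.
  by rewrite (eqP (a0 l)) mul0r.
have h1 : (1 <= \sum_(i | \adj B j i != 0%R) absz (\adj B j i))%N.
  rewrite (bigD1 i) //=; apply: (leq_trans _ (leq_addr _ _)).
  by rewrite absz_gt0.
have h2 : (absz (v ord0 j) <=
    \sum_(i | \adj B j i != 0%R) absz (\adj B j i) * absz (idot (row i B) v))%N.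
  apply: (@leq_trans (absz (\det B * v 0 j)%R)).
    by rewrite abszM leq_pmull // absz_gt0.
  rewrite adjv (bigID (fun i => \adj B j i != 0)) /= [X in _ + X]big1 ?addr0.
    elim/big_ind2 : _ => //= [a x b y ax byy|l _]; first by lia.
    by rewrite abszM.
  by move=> l /negPn/eqP ->; rewrite mul0r.
under eq_bigr => l _ do rewrite mulnS.
by rewrite big_split /= -add1n; exact: leq_add.
Qed.

Section CubeEstimates.
Variables (R : realType) (r : nat).
Hypothesis r_gt0 : (0 < r)%N.

Lemma sum_prod_rho_le (n : nat) (B : 'M[int]_r) : \det B != 0 ->
  \sum_(v <- cube r n) \prod_i rho R r.*2 (absz (idot (row i B) v)) <=
  (2 * r.*2.+1%:R) ^+ r.
Proof.
move=> dB.
apply: (le_trans (sum_prod_le n dB (fun=> rho_ge0 R r.*2))).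
rewrite prodr_const card_ord lerXn2r ?nnegrE ?mulr_ge0 ?sumr_ge0 ?ler0n //.
  by move=> i _; exact: rho_ge0.
by rewrite ler_pM2l ?sum_rho_le ?ltr0n // double_gt0.
Qed.

(** This is why roots of order [r.*2] are taken: losing one root in each of [r] directions costs
    only a square root in total. *)
Lemma rt_double_pow (n : nat) : rt R r.*2 n ^+ r = Num.sqrt n.+1%:R.
Proof.
rewrite -(@rt_pow R r.*2) ?double_gt0 // -muln2 exprM sqrtr_sqr ger0_norm //.
by rewrite exprn_ge0 // ltW ?rt_gt0.
Qed.

(** Multiplying the bound of [coord_le_adj] by all the weights cancels the [i]-th weight in the
    [i]-th term. *)
Lemma prod_wt_le_adj (B : 'M[int]_r) (v : 'rV[int]_r) (j : 'I_r) :
  \det B != 0 ->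
  \prod_i wt R (absz (idot (row i B) v)) <=
  wt R (absz (v 0%R j)) * \sum_(i | \adj B j i != 0) (absz (\adj B j i))%:R *
     \prod_(k | k != i) wt R (absz (idot (row k B) v)).
Proof.
move=> dB; rewrite mulrC -ler_pdivrMr ?wt_gt0 // invrK.
apply: (@le_trans _ _ ((\sum_(i | \adj B j i != 0)
    absz (\adj B j i) * (absz (idot (row i B) v)).+1)%N%:R *
    \prod_i wt R (absz (idot (row i B) v)))).
  rewrite mulrC ler_wpM2r ?prodr_ge0 //; first by move=> i _; exact: wt_ge0.
  by rewrite ler_nat coord_le_adj.
rewrite natr_sum mulr_suml; apply: ler_sum => i _.
rewrite natrM -mulrA ler_wpM2l ?ler0n // (bigD1 i) //= mulrA.
by rewrite mulfV ?mul1r // pnatr_eq0.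
Qed.

(** Coordinate [j] takes the place of functional [i]. In that direction boundedly many values occur;
    each other direction contributes a harmonic sum, at most a multiple of a root of order [r.*2],
    and [r] such roots give the square root. *)
Lemma sum_window_prod_le (B : 'M[int]_r) (i j : 'I_r) (K : nat) :
  \adj B j i != 0 ->
  exists2 C : R, 0 <= C & forall n,
    \sum_(v <- cube r (n + K) | (n <= absz (v 0%R j) + K)%N)
       \prod_(k | k != i) wt R (absz (idot (row k B) v))
    <= C * Num.sqrt n.+1%:R.
Proof.
move=> adji; set S := setrow B i j.
have dS : \det S != 0 by rewrite det_setrow.
(* [E] dominates both kinds of one-dimensional bound: the width of the window and the constant of
   the harmonic sum. *)
pose E : R := 2 * K.*2.+1%:R + 2 * r.*2.+1%:R.
have E0 : 0 <= E by rewrite addr_ge0 ?mulr_ge0 ?ler0n.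
(* Chosen so that [M.+1 <= D * n.+1] for the range [M] of the new coordinates. *)
pose D := (mxbound S * K.+1).+1.
exists (E ^+ r * Num.sqrt D%:R) => [|n].
  by rewrite mulr_ge0 ?exprn_ge0 ?sqrtr_ge0.
pose h (k : 'I_r) (m : nat) : R :=
  if k == i then ((n <= m + K) && (m <= n + K))%N%:R else wt R m.
have h0 k m : 0 <= h k m by rewrite /h; case: ifP => _; rewrite ?ler0n ?wt_ge0.
apply: (@le_trans _ _ (\sum_(v <- cube r (n + K))
    \prod_k h k (absz (idot (row k S) v)))).
  rewrite big_mkcond /= big_seq [leRHS]big_seq; apply: ler_sum => v vc.
  case: ifP => vj; last by rewrite prodr_ge0.
  rewrite [leRHS](bigD1 i) //= /h eqxx idot_row_setrow eqxx vj.
  (* Membership in the cube provides the upper end of the window. *)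
  have -> : (absz (v 0%R j) <= n + K)%N by move: vc; rewrite mem_cube => /forallP.
  rewrite mul1r le_eqVlt; apply/orP; left; apply/eqP.
  by apply: eq_bigr => k /negbTE ki; rewrite ki idot_row_setrow ki.
apply: (le_trans (sum_prod_le (n + K) dS h0)).
set M := (mxbound S * (n + K))%N.
apply: (@le_trans _ _ (\prod_(k < r) (E * rt R r.*2 M))).
  apply: ler_prod => k _; rewrite mulr_ge0 ?ler0n ?sumr_ge0 //= /h.
  case: eqP => ki.
    apply: (@le_trans _ _ E); last by rewrite ler_peMr ?rt_ge1.
    apply: (@le_trans _ _ (2 * K.*2.+1%:R)).
      by rewrite ler_pM2l ?ltr0n // sum_window_le.
    by rewrite lerDl mulr_ge0 ?ler0n.
  apply: (@le_trans _ _ (2 * r.*2.+1%:R * rt R r.*2 M)).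
    by rewrite -mulrA ler_pM2l ?ltr0n // sum_wt_le // double_gt0.
  by rewrite ler_wpM2r ?lerDr ?mulr_ge0 ?ler0n // ltW ?rt_gt0.
rewrite prodr_const card_ord exprMn rt_double_pow -mulrA ler_wpM2l ?exprn_ge0 //.
rewrite -sqrtrM ?ler0n // ler_sqrt ?mulr_ge0 ?ler0n // -natrM ler_nat /D /M.
nia.
Qed.

(** Used inside [cube r (n + K)], where it is a boundary layer of [cube r n]; the additive form
    avoids truncated subtraction. *)
Definition shell (n K : nat) (v : 'rV[int]_r) : bool :=
  [exists j, leq n (absz (v 0%R j) + K)].

(** The shell is covered by [r] slabs, one for each coordinate that may be large. On a slab,
    exchanging a functional for that coordinate gains a factor of order [1 / (n + 1)], while the
    remaining sum is at most of order [sqrt (n + 1)]. *)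
Lemma sum_shell_le (B : 'M[int]_r) (K : nat) : \det B != 0 ->
  exists2 C : R, 0 <= C & forall n,
    \sum_(v <- cube r (n + K) | shell n K v)
       \prod_i wt R (absz (idot (row i B) v)) <= C / Num.sqrt n.+1%:R.
Proof.
move=> dB.
pose P (C : 'I_r -> 'I_r -> R) (i j : 'I_r) := 0 <= C i j /\
  (\adj B j i != 0 -> forall n,
    \sum_(v <- cube r (n + K) | (n <= absz (v 0%R j) + K)%N)
       \prod_(k | k != i) wt R (absz (idot (row k B) v))
    <= C i j * Num.sqrt n.+1%:R).
have [C CP] : exists C, forall i j, P C i j.
  have /choice[C CP] : forall ij : 'I_r * 'I_r, exists c, P (fun _ _ => c) ij.1 ij.2.
    move=> [i j] /=; have [a0|a0] := eqVneq (\adj B j i) 0.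
      by exists 0; split; rewrite ?a0 ?eqxx.
    by have [c c0 cP] := sum_window_prod_le K a0; exists c; split.
  by exists (fun i j => C (i, j)) => i j; exact: (CP (i, j)).
exists (\sum_j \sum_(i | \adj B j i != 0) K.+1%:R * ((absz (\adj B j i))%:R * C i j)).
  apply: sumr_ge0 => j _; apply: sumr_ge0 => i _; have [c0 _] := CP i j.
  by rewrite !mulr_ge0 ?ler0n.
move=> n; have sn0 : 0 < Num.sqrt (n.+1%:R : R) by rewrite sqrtr_gt0 ltr0n.
apply: (@le_trans _ _ (\sum_j \sum_(v <- cube r (n + K) | (n <= absz (v 0%R j) + K)%N)
    \prod_i wt R (absz (idot (row i B) v)))).
  under [leRHS]eq_bigr => j _ do rewrite big_mkcond /=.
  rewrite exchange_big /= big_mkcond /=; apply: ler_sum => v _.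
  have pr0 : 0 <= \prod_i wt R (absz (idot (row i B) v)).
    by rewrite prodr_ge0 // => i _; exact: wt_ge0.
  case: ifP => [/existsP[j vj]|_].
    rewrite [leRHS](bigD1 j) //= vj lerDl sumr_ge0 // => l _; by case: ifP.
  by rewrite sumr_ge0 // => l _; case: ifP.
rewrite mulr_suml; apply: ler_sum => j _.
(* On the slab, [n <= absz (v 0 j) + K] gives [wt R (absz (v 0 j)) <= K.+1%:R / n.+1%:R]. *)
apply: (@le_trans _ _ (\sum_(v <- cube r (n + K) | (n <= absz (v 0%R j) + K)%N)
   K.+1%:R / n.+1%:R * \sum_(i | \adj B j i != 0) (absz (\adj B j i))%:R *
     \prod_(k | k != i) wt R (absz (idot (row k B) v)))).
  apply: ler_sum => v vj; apply: (le_trans (prod_wt_le_adj v j dB)).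
  rewrite ler_wpM2r //.
    apply: sumr_ge0 => i _; rewrite mulr_ge0 ?ler0n ?prodr_ge0 // => k _.
    exact: wt_ge0.
  rewrite ler_pdivlMr ?ltr0n // mulrC ler_pdivrMr ?ltr0n // -natrM ler_nat.
  nia.
rewrite -mulr_sumr exchange_big /= mulr_suml mulr_sumr; apply: ler_sum => i ai.
have [c0 /(_ ai n) cP] := CP i j.
rewrite -mulr_sumr.
apply: (@le_trans _ _ (K.+1%:R / n.+1%:R * ((absz (\adj B j i))%:R *
    (C i j * Num.sqrt n.+1%:R)))).
  by rewrite ler_wpM2l ?divr_ge0 ?ler0n // ler_wpM2l ?ler0n.
rewrite -[X in _ / X * _](@sqr_sqrtr _ n.+1%:R) ?ler0n //.
rewrite le_eqVlt; apply/orP; left; apply/eqP.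
by field; rewrite gt_eqF.
Qed.

End CubeEstimates.

(** * Real-valued modulus of complex numbers *)

Section Modulus.
Variable R : realType.
Implicit Types z w : R[i].

(** The norm of [R[i]] takes values in [R[i]] itself; passing to the real part allows estimates in
    the totally ordered field [R]. *)
Definition cmod z : R := complex.Re `|z|.

Lemma cmodE z : (cmod z)%:C = `|z|.
Proof. by rewrite /cmod RRe_real // normr_real. Qed.

Lemma cmod_ge0 z : 0 <= cmod z.
Proof. by rewrite -ler0c cmodE. Qed.

Lemma cmod_le z (x : R) : (cmod z <= x) = (`|z| <= x%:C).
Proof. by rewrite -cmodE lecR. Qed.

Lemma cmod0 : cmod 0 = 0.
Proof. by apply: complexI; rewrite cmodE normr0. Qed.

Lemma cmod1 : cmod 1 = 1.
Proof. by apply: complexI; rewrite cmodE normr1. Qed.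

Lemma cmodN z : cmod (- z) = cmod z.
Proof. by rewrite /cmod normrN. Qed.

Lemma cmodM z w : cmod (z * w) = cmod z * cmod w.
Proof. by apply: complexI; rewrite rmorphM /= !cmodE normrM. Qed.

Lemma cmodX z n : cmod (z ^+ n) = cmod z ^+ n.
Proof. by apply: complexI; rewrite rmorphXn /= !cmodE normrX. Qed.

Lemma cmodV z : cmod z^-1 = (cmod z)^-1.
Proof. by apply: complexI; rewrite fmorphV /= !cmodE normfV. Qed.

Lemma ler_cmodD z w : cmod (z + w) <= cmod z + cmod w.
Proof. by rewrite cmod_le rmorphD /= !cmodE ler_normD. Qed.

Lemma ler_cmodB z w : cmod (z - w) <= cmod z + cmod w.
Proof. by rewrite -(cmodN w) ler_cmodD. Qed.

Lemma ler_cmod_sum (T : Type) (s : seq T) (P : pred T) (F : T -> R[i]) :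
  cmod (\sum_(x <- s | P x) F x) <= \sum_(x <- s | P x) cmod (F x).
Proof.
elim/big_ind2 : _ => [|a x b y ax byy|//]; first by rewrite cmod0.
by apply: le_trans (ler_cmodD _ _) _; exact: lerD.
Qed.

Lemma cmod_int (m : int) : cmod m%:~R = (absz m)%:R.
Proof.
by apply: complexI; rewrite cmodE rmorph_nat -intr_norm -abszE pmulrn.
Qed.

Lemma cmod_eq0 z : (cmod z == 0) = (z == 0).
Proof. by rewrite -[in RHS]normr_eq0 -cmodE -(inj_eq (@complexI R)). Qed.

End Modulus.

(** * Decay of a single factor *)

Section LocalBounds.
Variable R : realType.

Lemma finite_int_bound (g : int -> R) (N : nat) :
  exists2 C : R, 0 <= C & forall m, (absz m <= N)%N -> `|g m| <= C.
Proof.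
elim: N => [|N [C C0 CP]].
  by exists `|g 0| => // m; rewrite leqn0 absz_eq0 => /eqP ->.
exists (C + `|g N.+1%:Z| + `|g (- N.+1%:Z)|); first by rewrite !addr_ge0.
move=> m; rewrite leq_eqVlt => /orP[/eqP mN|/CP mC].
  have [->|->] : m = N.+1%:Z \/ m = - N.+1%:Z by lia.
    by rewrite -addrA addrCA lerDl addr_ge0.
  by rewrite lerDr addr_ge0.
by rewrite -addrA; apply: (le_trans mC); rewrite lerDl addr_ge0.
Qed.

Lemma wt_small (N : nat) (m : int) : (absz m <= N)%N -> 1 <= N.+1%:R * wt R (absz m).
Proof. by move=> mN; rewrite /wt ler_pdivlMr ?ltr0n // mul1r ler_nat. Qed.

(** Clearing denominators leaves [1 + |m| <= (1 + |q|) (1 + |m - q|)]. *)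
Lemma wt_shift (m q : int) :
  wt R (absz (m - q)) <= (absz q).+1%:R * wt R (absz m).
Proof.
rewrite /wt ler_pdivlMr ?ltr0n // mulrC ler_pdivrMr ?ltr0n // -natrM ler_nat.
nia.
Qed.

(** For [absz m > N >= 2 * cmod b] the denominator has modulus at least half of [absz m]; the
    finitely many other [m], with a possible [0^-1 = 0], only affect the constant. *)
Lemma inv_shift_bound (b : R[i]) :
  exists2 C : R, 0 <= C & forall m : int,
    cmod (m%:~R + b)^-1 <= C * wt R (absz m).
Proof.
have [N Nb] : exists N : nat, 2 * cmod b <= N%:R.
  by exists (Num.truncn (2 * cmod b)).+1; apply/ltW; rewrite truncnS_gt.
have [C C0 CP] := finite_int_bound (fun m => cmod (m%:~R + b)^-1) N.
(* [N.+1%:R] offsets the weight at small [m]; [4] comes from [2 / |m| <= 4 / (|m| + 1)] for nonzero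
   [m]. *)
exists (C * N.+1%:R + 4); first by rewrite addr_ge0 ?mulr_ge0.
move=> m; rewrite mulrDl.
have [mN|mN] := leqP (absz m) N.
  rewrite ler_wpDr ?mulr_ge0 ?wt_ge0 //.
  apply: (le_trans (ler_norm _)); apply: (le_trans (CP m mN)).
  by rewrite -mulrA ler_peMr // wt_small.
rewrite ler_wpDl ?mulr_ge0 ?wt_ge0 //.
have m0 : (0 < (absz m)%:R :> R) by rewrite ltr0n; lia.
have bm : 2 * cmod b <= (absz m)%:R by apply: (le_trans Nb); rewrite ler_nat ltnW.
have zb : (absz m)%:R <= cmod (m%:~R + b) + cmod b.
  by rewrite -cmod_int -{1}(addrK b m%:~R) ler_cmodB.
have hz : (absz m)%:R / 2 <= cmod (m%:~R + b) by lra.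
rewrite cmodV /wt.
apply: (@le_trans _ _ (((absz m)%:R / 2)^-1)).
  by rewrite lef_pV2 // posrE; lra.
rewrite ler_pdivlMr ?ltr0n // invf_div mulrAC ler_pdivrMr //.
by rewrite -natrM -natrM ler_nat; lia.
Qed.

End LocalBounds.

Section Factors.
Variables (R : realType) (r : nat).
Local Notation func := ('rV[int]_r * R[i])%type.
Variable k : func -> nat.

(* [0^-1 = 0], so for [0 < k f] the factor also removes the points [f v = 0]. *)
Definition phi (f : func) (m : int) : R[i] :=
  if k f == 0%N then (m%:~R + f.2 == 0)%:R else ((m%:~R + f.2) ^+ k f)^-1.

(** The exponent is capped at [2], all that the summability argument uses. The case [k f = 0] also
    gets [2], because its factor has finite support. *)
Definition kap (f : func) : nat := if k f == 1%N then 1%N else 2%N.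

Lemma phi_bound (f : func) : exists2 C : R, 0 <= C & forall m : int,
  cmod (phi f m) <= C * wt R (absz m) ^+ kap f.
Proof.
rewrite /kap /phi; case: (k f) => [|[|n]] /=.
(* A zero of [m%:~R + f.2] has [absz m] equal to [cmod f.2], so the indicator is supported in
   [absz m <= N]. *)
- have [N Nb] : exists N : nat, cmod f.2 < N%:R.
    by exists (Num.truncn (cmod f.2)).+1; rewrite truncnS_gt.
  exists (N.+1%:R ^+ 2) => [|m]; first by rewrite exprn_ge0.
  have [z0|_] := eqVneq (m%:~R + f.2) 0; last first.
    by rewrite cmod0 mulr_ge0 ?exprn_ge0 ?wt_ge0.
  have mb : (absz m)%:R = cmod f.2 by rewrite -cmod_int (eqP (_ : m%:~R == - f.2)) ?cmodN // -addr_eq0 z0.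
  rewrite cmod1 -exprMn -[leLHS](expr1n _ 2) lerXn2r ?nnegrE ?mulr_ge0 ?wt_ge0 //.
  by apply: wt_small; rewrite -(ler_nat R) mb ltW.
- have [C C0 CP] := inv_shift_bound f.2.
  by exists C => // m; rewrite !expr1.
- have [C C0 CP] := inv_shift_bound f.2.
  exists (C ^+ n.+2) => [|m]; first by rewrite exprn_ge0.
  rewrite -exprVn cmodX; apply: (@le_trans _ _ ((C * wt R (absz m)) ^+ n.+2)).
    by rewrite lerXn2r ?nnegrE ?cmod_ge0 ?mulr_ge0 ?wt_ge0.
  rewrite exprMn ler_wpM2l ?exprn_ge0 // ler_wiXn2l ?wt_ge0 ?wt_le1 //.
Qed.

(** The difference of [1 / (m + b)] and [1 / (m - q + b)] is [- q] over the product of the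
    denominators, which gains one order of decay. *)
Lemma diff_phi_bound (f : func) (q : int) : k f = 1%N ->
  exists2 C : R, 0 <= C & forall m : int,
  cmod (phi f m - phi f (m - q)) <= C * wt R (absz m) ^+ 2.
Proof.
move=> kf; rewrite /phi kf /=.
have [C C0 CP] := inv_shift_bound f.2.
have [N Nb] : exists N : nat, cmod f.2 + (absz q)%:R < N%:R.
  by exists (Num.truncn (cmod f.2 + (absz q)%:R)).+1; rewrite truncnS_gt.
(* The first summand covers [absz m <= N], where both terms are at most [C]; the second covers the
   rest, where the choice of [N] keeps both denominators nonzero. *)
exists (2 * C * N.+1%:R ^+ 2 + (absz q)%:R * C * C * (absz q).+1%:R).
  by rewrite addr_ge0 ?mulr_ge0 ?exprn_ge0.
move=> m; rewrite !expr1 mulrDl.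
have [mN|mN] := leqP (absz m) N.
  rewrite ler_wpDr ?mulr_ge0 ?exprn_ge0 ?wt_ge0 //.
  apply: (le_trans (ler_cmodB _ _)).
  have CC m' : cmod (m'%:~R + f.2)^-1 <= C.
    by apply: (le_trans (CP m')); rewrite ler_piMr ?wt_le1.
  apply: (le_trans (lerD (CC _) (CC _))).
  have -> : C + C = 2 * C * 1 by ring.
  rewrite -[leRHS]mulrA ler_wpM2l ?mulr_ge0 // -exprMn exprn_ege1 //.
  exact: wt_small.
rewrite ler_wpDl ?mulr_ge0 ?exprn_ge0 ?wt_ge0 //.
have nz (m' : int) : (absz m <= absz m' + absz q)%N -> m'%:~R + f.2 != 0.
  move=> mm'; rewrite -cmod_eq0 gt_eqF //.
  have h1 : (absz m')%:R <= cmod (m'%:~R + f.2) + cmod f.2.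
    by rewrite -cmod_int -{1}(addrK f.2 m'%:~R) ler_cmodB.
  have h2 : (absz m)%:R <= (absz m')%:R + (absz q)%:R :> R by rewrite -natrD ler_nat.
  have h3 : N%:R < (absz m)%:R :> R by rewrite ltr_nat.
  lra.
have z0 := nz m (leq_addr _ _).
have z1 : (m - q)%:~R + f.2 != 0 by apply: nz; lia.
have -> : (m%:~R + f.2)^-1 - ((m - q)%:~R + f.2)^-1 =
    - (q%:~R * (m%:~R + f.2)^-1 * ((m - q)%:~R + f.2)^-1).
  move: z0 z1; rewrite rmorphB /= => z0 z1; field.
  by rewrite z0 z1.
rewrite cmodN !cmodM cmod_int.
have -> : (absz q)%:R * C * C * (absz q).+1%:R * wt R (absz m) ^+ 2 =
  (absz q)%:R * (C * wt R (absz m)) * (C * ((absz q).+1%:R * wt R (absz m))) by ring.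
rewrite !ler_pM ?mulr_ge0 ?cmod_ge0 //.
by apply: (le_trans (CP _)); rewrite ler_wpM2l ?wt_shift.
Qed.

End Factors.

(** * Products of factors: absolute summability *)

Lemma prodr_le_inj (K : numDomainType) (T : eqType) (I : finType) (s : seq T)
    (b : I -> T) (Z : T -> K) : uniq s -> injective b -> (forall i, b i \in s) ->
  (forall x, 0 <= Z x <= 1) -> \prod_(x <- s) Z x <= \prod_i Z (b i).
Proof.
move=> us bI bs Z01; rewrite -(big_map b xpredT Z).
set t := [seq b i | i <- index_enum I].
have ut : uniq t by rewrite map_inj_uniq ?index_enum_uniq.
rewrite (bigID (mem t)) /= -[X in X * _]big_filter.
have pt : perm_eq [seq x <- s | x \in t] t.
  apply: uniq_perm; rewrite ?filter_uniq // => x; rewrite mem_filter.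
  by apply: andb_idr => /mapP[i _ ->].
rewrite (perm_big _ pt) /= ler_piMr //.
  by apply: prodr_ge0 => x _; case/andP: (Z01 x).
by apply: prodr_ile1 => x _; exact: Z01.
Qed.

Lemma vecmx_inj (r : nat) (T : eqType) (vec : T -> 'rV[int]_r) (b : 'I_r -> T) :
  \det (vecmx vec b) != 0 -> injective b.
Proof.
move=> db i j bij; apply/eqP/negPn/negP => ij; move/eqP: db; apply.
by apply: (determinant_alternate ij) => l; rewrite !mxE bij.
Qed.

Lemma row_vecmx (r : nat) (T : Type) (vec : T -> 'rV[int]_r) (b : 'I_r -> T) i :
  row i (vecmx vec b) = vec (b i).
Proof. by apply/rowP => j; rewrite !mxE. Qed.

Lemma ex_argmax (T : eqType) (s : seq T) (g : T -> nat) : s != [::] ->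
  exists2 x, x \in s & forall z, z \in s -> (g z <= g x)%N.
Proof.
elim: s => // x [|x' s] IHs _.
  by exists x; rewrite ?mem_seq1 // => z; rewrite mem_seq1 => /eqP ->.
have [//|w ws wP] := IHs.
have [gw|gw] := leqP (g x) (g w).
  exists w; first by rewrite inE ws orbT.
  by move=> z; rewrite inE => /orP[/eqP ->|/wP].
exists x; rewrite ?mem_head // => z; rewrite inE => /orP[/eqP -> //|/wP].
by move=> /leq_trans; apply; exact: ltnW.
Qed.

Section Products.
Variables (R : realType) (r : nat).
Hypothesis r_gt0 : (0 < r)%N.
Local Notation func := ('rV[int]_r * R[i])%type.

Definition spans (s : seq func) : Prop :=
  exists2 b : 'I_r -> func, forall i, b i \in s & \det (vecmx fst b) != 0.

Definition fprod (s : seq func) (psi : func -> int -> R[i]) (v : 'rV[int]_r) : R[i] :=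
  \prod_(f <- s) psi f (idot f.1 v).

Definition decays (s : seq func) (psi : func -> int -> R[i]) (kp : func -> nat) :=
  forall f, f \in s -> exists2 C : R, 0 <= C & forall m : int,
    cmod (psi f m) <= C * wt R (absz m) ^+ kp f.

Lemma cmod_fprod_le (s : seq func) psi kp : decays s psi kp ->
  exists2 C : R, 0 <= C & forall v,
    cmod (fprod s psi v) <= C * \prod_(f <- s) wt R (absz (idot f.1 v)) ^+ kp f.
Proof.
elim: s => [|f s IHs] dec.
  by exists 1 => // v; rewrite /fprod !big_nil cmod1 mul1r.
have [C C0 CP] := IHs (fun g gs => dec g (mem_behead (s := f :: s) gs)).
have [D D0 DP] := dec f (mem_head _ _).
exists (D * C) => [|v]; first exact: mulr_ge0.
rewrite /fprod !big_cons cmodM mulrACA ler_pM ?cmod_ge0 //; exact: CP.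
Qed.

(** All exponents are positive and all weights at most [1], so it suffices to keep the weights along
    a basis inside [s] and apply [sum_shell_le]. *)
Lemma sum_shell_fprod_le (s : seq func) psi kp (K : nat) : uniq s -> spans s ->
  (forall f, 0 < kp f)%N -> decays s psi kp ->
  exists2 C : R, 0 <= C & forall n,
    \sum_(v <- cube r (n + K) | shell n K v) cmod (fprod s psi v)
      <= C / Num.sqrt n.+1%:R.
Proof.
move=> us [b bs db] kp0 /cmod_fprod_le[A A0 AP].
have [C C0 CP] := @sum_shell_le R r r_gt0 _ K db.
exists (A * C) => [|n]; first exact: mulr_ge0.
apply: (@le_trans _ _ (A * \sum_(v <- cube r (n + K) | shell n K v)
    \prod_i wt R (absz (idot (row i (vecmx fst b)) v)))).
  rewrite mulr_sumr; apply: ler_sum => v _; apply: (le_trans (AP v)).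
  rewrite ler_wpM2l //.
  under [leRHS]eq_bigr => i _ do rewrite row_vecmx.
  apply: (@le_trans _ _ (\prod_(f <- s) wt R (absz (idot f.1 v)))).
    apply: ler_prod => f _; rewrite exprn_ge0 ?wt_ge0 //=.
    by rewrite -[leRHS]expr1 ler_wiXn2l ?wt_ge0 ?wt_le1.
  apply: (prodr_le_inj us (vecmx_inj db) bs) => f.
  by rewrite wt_ge0 wt_le1.
by rewrite -mulrA ler_wpM2l.
Qed.

(* The factor of the functional [f0] largest at [v] is shared out equally among
   the members of a spanning family that does not use up [f0]. *)
Lemma prod_wt_le_rho (s : seq func) (kp : func -> nat) (f0 : func)
    (b : 'I_r -> func) (v : 'rV[int]_r) :
  uniq s -> (forall f, 0 < kp f)%N -> f0 \in s ->
  (forall f, f \in s -> (absz (idot f.1 v) <= absz (idot f0.1 v))%N) ->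
  (forall i, b i \in s) -> \det (vecmx fst b) != 0 ->
  (kp f0 = 2)%N \/ (forall i, b i \in rem f0 s) ->
  \prod_(f <- s) wt R (absz (idot f.1 v)) ^+ kp f <=
  \prod_i rho R r.*2 (absz (idot (b i).1 v)).
Proof.
move=> us kp0 f0s f0max bs db hb.
have W0 (f : func) : 0 <= wt R (absz (idot f.1 v)) by exact: wt_ge0.
have W01 (f : func) : 0 <= wt R (absz (idot f.1 v)) <= 1 by rewrite wt_ge0 wt_le1.
have bI := vecmx_inj db.
have Wk (f : func) : wt R (absz (idot f.1 v)) ^+ kp f <= wt R (absz (idot f.1 v)).
  by rewrite -[leRHS]expr1 ler_wiXn2l ?wt_ge0 ?wt_le1.
apply: (@le_trans _ _ (wt R (absz (idot f0.1 v)) *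
    \prod_i wt R (absz (idot (b i).1 v)))).
  rewrite (perm_big _ (perm_to_rem f0s)) big_cons /=.
  case: hb => [k2|brem].
    rewrite k2 expr2 -mulrA ler_wpM2l //.
    apply: (@le_trans _ _ (\prod_(f <- s) wt R (absz (idot f.1 v)))).
      rewrite [leRHS](perm_big _ (perm_to_rem f0s)) big_cons /= ler_wpM2l //.
      by apply: ler_prod => f _; rewrite exprn_ge0 //= Wk.
    exact: (prodr_le_inj us bI bs W01).
  apply: ler_pM => //; first by rewrite exprn_ge0.
    by apply: prodr_ge0 => f _; rewrite exprn_ge0.
  apply: (@le_trans _ _ (\prod_(f <- rem f0 s) wt R (absz (idot f.1 v)))).
    by apply: ler_prod => f _; rewrite exprn_ge0 //= Wk.
  exact: (prodr_le_inj (rem_uniq _ us) bI brem W01).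
rewrite /rho big_split /= mulrC ler_wpM2l ?prodr_ge0 //.
set M := absz (idot f0.1 v).
rewrite prodfV /wt lef_pV2 ?posrE ?ltr0n ?prodr_gt0 //; last first.
  by move=> i _; exact: rt_gt0.
(* Maximality of [f0] bounds every root by the one at [M]; the product of [r] of these is
   [sqrt (M + 1)], at most [M + 1]. *)
apply: (@le_trans _ _ (\prod_(i < r) rt R r.*2 M)).
  apply: ler_prod => i _; rewrite ltW ?rt_gt0 //=; apply: le_rt; exact: f0max.
rewrite prodr_const card_ord rt_double_pow // -[leRHS]sqr_sqrtr ?ler0n // expr2.
by rewrite ler_peMl ?sqrtr_ge0 // -[leLHS]sqrtr1 ler_sqrt ?ler1n ?ltr0n.
Qed.

(** The basis used at [v] depends on which functional is largest there. Summing the bounds over all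
    candidates removes this dependence, and each candidate contributes a sum controlled by
    [sum_prod_rho_le]. *)
Lemma sum_fprod_bounded (s : seq func) psi kp : uniq s -> spans s ->
  (forall f, 0 < kp f)%N -> decays s psi kp ->
  (forall f, f \in s -> (kp f = 2)%N \/ spans (rem f s)) ->
  exists C : R, forall n, \sum_(v <- cube r n) cmod (fprod s psi v) <= C.
Proof.
move=> us sp kp0 /cmod_fprod_le[A A0 AP] kps.
have s0 : s != [::].
  by case: sp => b bs _; have := bs (Ordinal r_gt0); case: (s).
have /choice[b bP] : forall f, exists b : 'I_r -> func, f \in s ->
    [/\ forall i, b i \in s, \det (vecmx fst b) != 0 &
        (kp f = 2)%N \/ (forall i, b i \in rem f s)].
  move=> f; have [fs|_] := boolP (f \in s); last by exists (fun=> f).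
  case: (kps f fs) => [k2|[b bs db]].
    by case: sp => b bs db; exists b => _; split => //; left.
  by exists b => _; split => // [i|]; [exact: mem_rem (bs i)|right].
exists (A * \sum_(f <- s) (2 * r.*2.+1%:R) ^+ r) => n.
apply: (@le_trans _ _ (A * \sum_(v <- cube r n) \sum_(f <- s)
   `|\prod_i rho R r.*2 (absz (idot (b f i).1 v))|)).
  rewrite mulr_sumr; apply: ler_sum => v _; apply: (le_trans (AP v)).
  rewrite ler_wpM2l //.
  have [f0 f0s f0max] := ex_argmax (fun f : func => absz (idot f.1 v)) s0.
  have [bs db hb] := bP f0 f0s.
  apply: (le_trans (prod_wt_le_rho us kp0 f0s f0max bs db hb)).
  rewrite (perm_big _ (perm_to_rem f0s)) big_cons /=.
  by rewrite ler_wpDr ?sumr_ge0 // ler_norm.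
rewrite ler_wpM2l // exchange_big /= big_seq [leRHS]big_seq.
apply: ler_sum => f /bP[_ db _].
apply: le_trans (sum_prod_rho_le R r_gt0 n db).
apply: ler_sum => v _; rewrite ger0_norm ?prodr_ge0 //; last first.
  by move=> i _; exact: rho_ge0.
by under [leRHS]eq_bigr => i _ do rewrite row_vecmx.
Qed.

End Products.

(** * Summation by parts along an integral direction *)

Lemma sum_shift_sub_le (R : realType) (r : nat) (e : 'rV[int]_r) (K n : nat) (G : 'rV[int]_r -> R[i]) :
  (forall j, absz (e 0%R j) <= K)%N ->
  cmod (\sum_(v <- cube r n) G v - \sum_(v <- cube r n) G (v - e)) <=
  \sum_(v <- cube r (n + K) | shell n K v) cmod (G v).
Proof.
move=> eK.
(* Both sums become sums over the larger cube with indicator coefficients; off the shell a point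
   lies in the cube and in its translate, so the two terms cancel. *)
have restrict (t : seq 'rV[int]_r) : uniq t -> {subset t <= cube r (n + K)} ->
    \sum_(v <- t) G v = \sum_(v <- cube r (n + K)) (v \in t)%:R * G v.
  move=> ut st.
  transitivity (\sum_(v <- [seq v <- cube r (n + K) | v \in t]) G v).
    apply: perm_big; apply: uniq_perm => [//||v].
      by rewrite filter_uniq ?cube_uniq.
    by rewrite mem_filter; symmetry; apply: andb_idr => /st.
  rewrite big_filter big_mkcond; apply: eq_bigr => v _.
  by case: (v \in t); rewrite ?mul1r ?mul0r.
set t := [seq v - e | v <- cube r n].
have ut : uniq t by rewrite map_inj_uniq ?cube_uniq //; exact: addIr.
rewrite -(big_map (fun v => v - e) xpredT G) -/t.
rewrite (restrict _ (cube_uniq r n)); last first.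
  by move=> v; rewrite !mem_cube => /forallP vn; apply/forallP => j; have := vn j; lia.
rewrite (restrict _ ut); last first.
  move=> _ /mapP[v vn ->]; move: vn; rewrite !mem_cube => /forallP vn.
  apply/forallP => j; rewrite !mxE; have := vn j; have := eK j.
  by move: (v 0 j) (e 0 j) => x z; lia.
rewrite -sumrB; apply: (le_trans (ler_cmod_sum _ _ _)).
rewrite [leRHS]big_mkcond; apply: ler_sum => v _.
rewrite -mulrBl cmodM; case: ifP => [_|/negbT/existsPn sh].
  rewrite ler_piMl ?cmod_ge0 //.
  by case: (v \in cube r n); case: (v \in t);
    rewrite ?subrr ?subr0 ?sub0r ?cmodN ?cmod0 ?cmod1.
have -> : v \in cube r n.
  by rewrite mem_cube; apply/forallP => j; have := sh j; lia.
have -> : v \in t.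
  apply/mapP; exists (v + e); last by rewrite addrK.
  rewrite mem_cube; apply/forallP => j; rewrite mxE; have := sh j; have := eK j.
  by move: (v 0 j) (e 0 j) => x z; lia.
by rewrite subrr cmod0 mul0r.
Qed.

Section Characters.
Variables (R : realType) (r : nat).
Implicit Types (y : 'rV[R]_r) (u v : 'rV[int]_r).

Definition cexpi (t : R) : R[i] := cexp (0 +i* t).

Lemma cexpiE (t : R) : cexpi t = cos t +i* sin t.
Proof. by rewrite /cexpi /cexp /= expR0 mul1r. Qed.

Lemma cexpiD (a b : R) : cexpi (a + b) = cexpi a * cexpi b.
Proof.
by rewrite !cexpiE cosD sinD; simpc; rewrite [X in _ +i* X]addrC.
Qed.

Lemma cmod_cexpi (t : R) : cmod (cexpi t) = 1.
Proof. by rewrite cexpiE /cmod normc_def /= cos2Dsin2 sqrtr1. Qed.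

Lemma dotDr y u v : dot y (ofZ R (u + v)) = dot y (ofZ R u) + dot y (ofZ R v).
Proof.
rewrite /dot -big_split /=; apply: eq_bigr => j _.
by rewrite !mxE rmorphD mulrDr.
Qed.

Definition echar y v : R[i] := cexpi (2 * pi * dot y (ofZ R v)).

Lemma echarD y u v : echar y (u + v) = echar y u * echar y v.
Proof. by rewrite /echar dotDr mulrDr cexpiD. Qed.

Lemma cmod_echar y v : cmod (echar y v) = 1.
Proof. exact: cmod_cexpi. Qed.

End Characters.

Section ByParts.
Variables (R : realType) (r : nat).
Hypothesis r_gt0 : (0 < r)%N.
Local Notation func := ('rV[int]_r * R[i])%type.

Definition Tsum (s : seq func) (psi : func -> int -> R[i]) (n : nat)
    (y : 'rV[R]_r) : R[i] := \sum_(v <- cube r n) echar y v * fprod s psi v.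

Definition diffat (psi : func -> int -> R[i]) (c : func) (q : int)
    (f : func) (m : int) : R[i] :=
  if f == c then psi f m - psi f (m - q) else psi f m.

Lemma fprod_diffat (s : seq func) psi (c : func) (e v : 'rV[int]_r) :
  uniq s -> c \in s -> (forall f, f \in s -> f != c -> idot f.1 e = 0) ->
  fprod s (diffat psi c (idot c.1 e)) v = fprod s psi v - fprod s psi (v - e).
Proof.
move=> us cs orth; rewrite /fprod !(perm_big _ (perm_to_rem cs)) /= !big_cons.
have -> : \prod_(j <- rem c s) psi j (idot j.1 (v - e)) =
    \prod_(j <- rem c s) psi j (idot j.1 v).
  rewrite big_seq [RHS]big_seq; apply: eq_bigr => f.
  rewrite (mem_rem_uniq _ us) inE => /andP[fc fs].
  by rewrite idotDr idotNr (orth f) // subr0.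
have -> : \prod_(j <- rem c s) diffat psi c (idot c.1 e) j (idot j.1 v) =
    \prod_(j <- rem c s) psi j (idot j.1 v).
  rewrite big_seq [RHS]big_seq; apply: eq_bigr => f.
  rewrite (mem_rem_uniq _ us) inE => /andP[fc fs].
  by rewrite /diffat (negbTE fc).
by rewrite /diffat eqxx idotDr idotNr mulrBl.
Qed.

(** Translating the summation variable by [e] brings out [echar y e] and shifts only the factor of
    [c]. The error is a sum over a shell, and its bound is uniform in [y] since characters have
    modulus [1]. *)
Lemma summation_by_parts (s : seq func) psi kp (c : func) (e : 'rV[int]_r) :
  uniq s -> spans s -> (forall f, 0 < kp f)%N -> decays s psi kp ->
  c \in s -> (forall f, f \in s -> f != c -> idot f.1 e = 0) ->
  exists2 C : R, 0 <= C & forall n y,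
    cmod ((1 - echar y e) * Tsum s psi n y -
          Tsum s (diffat psi c (idot c.1 e)) n y) <= C / Num.sqrt n.+1%:R.
Proof.
move=> us sp kp0 dec cs orth.
pose K : nat := (\sum_j absz (e 0%R j))%N.
have eK j : (absz (e 0%R j) <= K)%N by rewrite /K (bigD1 j) //= leq_addr.
have [C C0 CP] := sum_shell_fprod_le r_gt0 K us sp kp0 dec.
exists C => // n y; apply: le_trans (CP n).
pose G v := echar y v * fprod s psi v.
have -> : (1 - echar y e) * Tsum s psi n y -
    Tsum s (diffat psi c (idot c.1 e)) n y =
    - echar y e * (\sum_(v <- cube r n) G v - \sum_(v <- cube r n) G (v - e)).
  have -> : Tsum s (diffat psi c (idot c.1 e)) n y =
      \sum_(v <- cube r n) G v - echar y e * \sum_(v <- cube r n) G (v - e).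
    rewrite mulr_sumr -sumrB; apply: eq_bigr => v _.
    by rewrite fprod_diffat // mulrBr /G mulrA -echarD (addrC e) subrK.
  rewrite /Tsum -/G; ring.
rewrite cmodM cmodN cmod_echar mul1r.
apply: (le_trans (sum_shift_sub_le n G eK)).
by apply: ler_sum => v _; rewrite cmodM cmod_echar mul1r.
Qed.

Variable k : func -> nat.

(** The factors left after summation by parts at every member of [cs]; [kaps] records their
    decay. *)
Definition psis (cs : seq func) (e : func -> 'rV[int]_r) (f : func) (m : int) :
    R[i] :=
  if f \in cs then phi k f m - phi k f (m - idot f.1 (e f)) else phi k f m.

Definition kaps (cs : seq func) (f : func) : nat :=
  if f \in cs then 2%N else kap k f.

Lemma kaps_gt0 (cs : seq func) (f : func) : (0 < kaps cs f)%N.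
Proof. by rewrite /kaps /kap; case: ifP => // _; case: ifP. Qed.

Lemma decays_psis (s cs : seq func) e : (forall c, c \in cs -> k c = 1%N) ->
  decays s (psis cs e) (kaps cs).
Proof.
move=> k1 f _; rewrite /psis /kaps; case: ifP => [fcs|_].
  by apply: diff_phi_bound; exact: k1.
exact: phi_bound.
Qed.

(** By induction on [cs]: factors already differenced still decay, so [summation_by_parts] applies
    again, and the earlier error is multiplied by [1 - echar y (e c)], of modulus at most [2]. *)
Lemma iterated_by_parts (s cs : seq func) (e : func -> 'rV[int]_r) :
  uniq s -> spans s -> uniq cs -> {subset cs <= s} ->
  (forall c, c \in cs -> k c = 1%N) ->
  (forall c f, c \in cs -> f \in s -> f != c -> idot f.1 (e c) = 0) ->
  exists2 C : R, 0 <= C & forall n y,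
    cmod (\prod_(c <- cs) (1 - echar y (e c)) * Tsum s (phi k) n y -
          Tsum s (psis cs e) n y) <= C / Num.sqrt n.+1%:R.
Proof.
move=> us sp; elim: cs => [|c cs IHcs] /=.
  exists 0 => // n y; rewrite big_nil mul1r mul0r.
  have -> : Tsum s (psis [::] e) n y = Tsum s (phi k) n y by [].
  by rewrite subrr cmod0.
move=> /andP[ccs ucs] css k1 orth.
have [|c' cc'|c' f cc'|C C0 CP] := IHcs ucs.
- by move=> f fcs; apply: css; rewrite inE fcs orbT.
- by apply: k1; rewrite inE cc' orbT.
- by apply: orth; rewrite inE cc' orbT.
have [D D0 DP] := summation_by_parts us sp (kaps_gt0 cs)
  (@decays_psis s cs e (fun f fcs => k1 f (mem_behead (s := c :: cs) fcs)))
  (css c (mem_head _ _)) (fun f => orth c f (mem_head _ _)).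
exists (2 * C + D) => [|n y]; first by rewrite addr_ge0 ?mulr_ge0.
(* As [c] is not in [cs], its factor is still [phi k c], and differencing it yields exactly
   [psis (c :: cs) e]. *)
have eqT : Tsum s (diffat (psis cs e) c (idot c.1 (e c))) n y =
    Tsum s (psis (c :: cs) e) n y.
  apply: eq_bigr => v _; congr (_ * _); apply: eq_bigr => f _.
  rewrite /diffat /psis inE; case: eqP => [->|//] /=.
  by rewrite (negbTE ccs).
rewrite big_cons -eqT.
have eqD (a b t u w : R[i]) : a * b * t - w = a * (b * t - u) + (a * u - w).
  by ring.
rewrite (eqD _ _ _ (Tsum s (psis cs e) n y)).
apply: (le_trans (ler_cmodD _ _)); rewrite [leRHS]mulrDl.
apply: lerD => //; rewrite cmodM -mulrA ler_pM ?cmod_ge0 //.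
apply: (le_trans (ler_cmodB _ _)); rewrite cmod1 cmod_echar.
by rewrite -[2]natr1.
Qed.

Lemma cvg_div_sqrt (C : R) : (C / Num.sqrt n.+1%:R) @[n --> \oo] --> (0 : R).
Proof.
rewrite -[X in _ --> X](mulr0 C); apply: cvgMr.
have -> : (fun n : nat => (Num.sqrt n.+1%:R)^-1 : R) =
    (fun n => Num.sqrt (harmonic n)).
  by apply/funext => n; rewrite /harmonic /= sqrtrV ?ler0n.
rewrite -[X in _ --> X](@sqrtr0 R).
apply: (@cvg_comp _ _ _ (@harmonic R) Num.sqrt _ (nbhs 0)).
  exact: cvg_harmonic.
exact: sqrt_continuous.
Qed.

(** After summation by parts the series has a majorant free of [y], whose tail is [limn a - a n].
    The boundary errors at [n] and at [m] both obey the bound at [n]; hence the factor [2] in the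
    rate. *)
Lemma Tsum_uniform_cauchy (s cs : seq func) (e : func -> 'rV[int]_r) :
  uniq s -> spans s -> uniq cs -> {subset cs <= s} ->
  (forall c, c \in cs -> k c = 1%N) ->
  (forall c f, c \in cs -> f \in s -> f != c -> idot f.1 (e c) = 0) ->
  (forall f, f \in s -> kaps cs f = 2%N \/ spans (rem f s)) ->
  exists2 d : nat -> R, d @ \oo --> (0 : R) & forall n m y, (n <= m)%N ->
    cmod (\prod_(c <- cs) (1 - echar y (e c)) * Tsum s (phi k) m y -
          \prod_(c <- cs) (1 - echar y (e c)) * Tsum s (phi k) n y) <= d n.
Proof.
move=> us sp ucs css k1 orth kps.
have [C C0 CP] := iterated_by_parts us sp ucs css k1 orth.
have [A AP] := sum_fprod_bounded r_gt0 us sp (kaps_gt0 cs)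
  (@decays_psis s cs e k1) kps.
pose a n := \sum_(v <- cube r n) cmod (fprod s (psis cs e) v).
have sub_cube n m : (n <= m)%N -> {subset cube r n <= cube r m}.
  move=> nm v; rewrite !mem_cube => /forallP vn; apply/forallP => j.
  exact: leq_trans (vn j) nm.
have and_ : {homo a : n m / (n <= m)%N >-> n <= m}.
  move=> n m nm; apply: ler_sum_uniq_sub; rewrite ?cube_uniq //.
    exact: sub_cube.
  by move=> v; exact: cmod_ge0.
have acvg : cvgn a.
  apply: nondecreasing_is_cvgn => //; exists A => _ [n _ <-]; exact: AP.
exists (fun n => (2 * C) / Num.sqrt n.+1%:R + (limn a - a n)).
  rewrite -[X in _ --> X]addr0; apply: cvgD; first exact: cvg_div_sqrt.
  rewrite -(subrr (limn a)); apply: cvgB => //; exact: cvg_cst.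
move=> n m y nm.
set P := \prod_(c <- cs) _.
have -> : P * Tsum s (phi k) m y - P * Tsum s (phi k) n y =
  (P * Tsum s (phi k) m y - Tsum s (psis cs e) m y)
  - (P * Tsum s (phi k) n y - Tsum s (psis cs e) n y)
  + (Tsum s (psis cs e) m y - Tsum s (psis cs e) n y) by ring.
apply: (le_trans (ler_cmodD _ _)); apply: lerD.
  apply: (le_trans (ler_cmodB _ _)); rewrite mulr_natl mulr2n mulrDl.
  apply: lerD; last exact: CP.
  apply: (le_trans (CP m y)); rewrite ler_wpM2l // lef_pV2 ?posrE ?sqrtr_gt0 ?ltr0n //.
  by rewrite ler_sqrt ?ltr0n // ler_nat.
apply: (@le_trans _ _ (a m - a n)); last first.
  by rewrite lerB // nondecreasing_cvgn_le.
have split_cube (V : zmodType) (F : 'rV[int]_r -> V) : \sum_(v <- cube r m) F v =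
    \sum_(v <- cube r n) F v + \sum_(v <- cube r m | v \notin cube r n) F v.
  rewrite (bigID (mem (cube r n))) /=; congr (_ + _); rewrite -big_filter.
  apply: perm_big; apply: uniq_perm; rewrite ?filter_uniq ?cube_uniq // => v.
  by rewrite mem_filter; apply: andb_idr => /(sub_cube _ _ nm).
have addK (V : zmodType) (x z : V) : x + z - x = z by rewrite addrAC subrr add0r.
rewrite /Tsum /a !split_cube !addK; apply: (le_trans (ler_cmod_sum _ _ _)).
by apply: ler_sum => v _; rewrite cmodM cmod_echar mul1r.
Qed.

End ByParts.

(** * Coloops, their directions, and the partial sums [Zsum] *)

Lemma det_orthogonal0 (r : nat) (B : 'M[int]_r) (e : 'rV[int]_r) :
  \det B != 0 -> (forall i, idot (row i B) e = 0) -> e = 0.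
Proof.
move=> dB oe.
have Be : B *m e^T = 0.
  apply/colP => i; rewrite [RHS]mxE -(oe i) mxE; apply: eq_bigr => j _.
  by rewrite !mxE.
have := congr1 (mulmx (\adj B)) Be; rewrite mulmxA mul_adj_mx mul_scalar_mx mulmx0.
move=> /colP de; apply/rowP => j; apply: (mulfI dB).
by have := de j; rewrite !mxE mulr0.
Qed.

Section Coloops.
Variables (R : realType) (r : nat).
Local Notation func := ('rV[int]_r * R[i])%type.

Lemma cexpi_int (m : int) : cexpi (2 * pi * m%:~R : R) = 1.
Proof.
have cn (n : nat) : cexpi (2 * pi * n%:R : R) = 1.
  elim: n => [|n IHn]; first by rewrite mulr0 cexpiE cos0 sin0.
  rewrite -[n.+1%:R]natr1 mulrDr cexpiD IHn mul1r mulr1 mulr_natl cexpiE cos2pi sin2pi.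
  by [].
case: (intP m) => [|n|n]; [exact: (cn 0)|exact: cn|].
have := cexpiD (2 * pi * n.+1%:R : R) (2 * pi * (- n.+1%:Z)%:~R).
rewrite rmorphN /= mulrN addrN cn mul1r => <-.
by rewrite cexpiE cos0 sin0.
Qed.

(** Periodicity reduces to the fractional part [u]. Then [cos (2 pi u) = 1] forces [sin (pi u) = 0],
    whereas the sine is positive strictly between [0] and [pi]. *)
Lemma cexpi_eq1 (t : R) : cexpi (2 * pi * t) = 1 -> exists m : int, t = m%:~R.
Proof.
move=> t1; exists (Num.floor t).
set u := t - (Num.floor t)%:~R.
have u01 : 0 <= u < 1.
  by rewrite subr_ge0 floor_le ltrBlDl -intrD1 floorD1_gt.
have : cexpi (pi * u + pi * u) = 1.
  rewrite -[RHS]t1; have -> : t = (Num.floor t)%:~R + u by rewrite addrC subrK.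
  rewrite [in RHS]mulrDr [RHS]cexpiD cexpi_int mul1r; congr cexpi; ring.
rewrite cexpiE cosD => -[c1 _].
have s0 : sin (pi * u) = 0.
  have := cos2Dsin2 (pi * u); rewrite !expr2 => cs.
  apply/eqP; rewrite -sqrf_eq0 expr2; apply/eqP; lra.
have [u0|u0] := ltP 0 u; last by apply/eqP; rewrite -subr_eq0 -/u; apply/eqP; lra.
have : 0 < sin (pi * u).
  apply: sin_gt0_pi; rewrite mulr_gt0 ?pi_gt0 //= -[ltRHS]mulr1 ltr_pM2l ?pi_gt0 //.
  by case/andP: u01.
by rewrite s0 ltxx.
Qed.

Lemma dot_ofZ (u v : 'rV[int]_r) : dot (ofZ R u) (ofZ R v) = (idot u v)%:~R.
Proof.
by rewrite /dot /idot rmorph_sum; apply: eq_bigr => j _; rewrite !mxE rmorphM.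
Qed.

(** Expand [h] in a basis taken from [L]. If [f] belongs to it, pairing with [e] leaves only the
    term of [f], and [f.1] is not orthogonal to [e], as otherwise [e] would be orthogonal to a
    basis; so the coefficient of [f] vanishes. *)
Lemma mem_hyp_orthogonal (L : {fset func}) (f : func) (e : 'rV[int]_r)
    (h : 'rV[R]_r) : spans (enum_fset L) -> e != 0 ->
  (forall g, g \in L -> g != f -> idot g.1 e = 0) ->
  dot h (ofZ R e) = 0 -> h \in hyp (L `\ f)%fset.
Proof.
move=> [b bL db] e0 orth he.
pose M := map_mx (intr : int -> R) (vecmx fst b).
have uM : M \in unitmx by rewrite unitmxE unitfE det_map_mx intr_eq0.
pose c := h *m invmx M.
have hE : h = \sum_i c 0 i *: ofZ R (b i).1.
  rewrite -[LHS](mulmxKV uM) -/c; apply/rowP => j; rewrite mxE summxE.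
  by apply: eq_bigr => i _; rewrite !mxE.
have dotE : \sum_i c 0 i * (idot (b i).1 e)%:~R = 0.
  transitivity (dot h (ofZ R e)) => //; rewrite [in RHS]hE /dot.
  transitivity (\sum_i \sum_j c 0 i * (ofZ R (b i).1 0 j * ofZ R e 0 j)).
    by apply: eq_bigr => i _; rewrite -dot_ofZ /dot mulr_sumr.
  rewrite exchange_big /=; apply: eq_bigr => j _; rewrite summxE mulr_suml.
  by apply: eq_bigr => i _; rewrite mulrA; congr (_ * _); rewrite [RHS]mxE.
have fe0 i : b i = f -> idot f.1 e != 0.
  move=> bif; apply: contra e0 => /eqP fe; apply/eqP.
  apply: (det_orthogonal0 db) => l; rewrite row_vecmx.
  by have [->//|blf] := eqVneq (b l) f; exact: orth.
rewrite hE; apply: memv_suml => i _.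
have [bif|bif] := eqVneq (b i) f.
  suff -> : c 0 i = 0 by rewrite scale0r mem0v.
  move: dotE; rewrite (bigD1 i) //= big1 ?addr0 => [/eqP|l li].
    by rewrite mulf_eq0 intr_eq0 bif (negbTE (fe0 i bif)) orbF => /eqP.
  rewrite (orth (b l)) ?mulr0 // -bif; apply: contra li => /eqP.
  by move=> /(vecmx_inj db) ->.
apply: memvZ; apply: memv_span; apply: map_f.
by apply/imfsetP; exists (b i) => //=; rewrite !inE bif bL.
Qed.

Lemma spans_full (L : {fset func}) : Zrank (Zspan (vecs L)) r -> spans (enum_fset L).
Proof.
move=> hL; have [//|[e e0 eL]] := basis_or_orthogonal fst (enum_fset L).
case/eqP: e0; apply: (Zrank_orthogonal0 hL) => a /imfsetP[f /= fL ->].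
exact: eL.
Qed.

(** Should [echar y e] be [1], then [y] pairs with [e] to an integer [j]. Primitivity supplies an
    integral [m] with [idot e m = 1], so [y] minus [j *: m] is orthogonal to [e] and lies in the
    hyperplane, which puts [y] in an excluded set. *)
Lemma coloop_direction (L : {fset func}) (k : func -> nat) (f : func) :
  spans (enum_fset L) -> f \in L -> k f = 1%N -> ~ spans (rem f (enum_fset L)) ->
  exists2 e : 'rV[int]_r, (forall g, g \in L -> g != f -> idot g.1 e = 0) &
    forall y, ydom L k y -> echar y e != 1.
Proof.
move=> sL fL kf nsp.
have [//|[e0 e00 e0L]] := basis_or_orthogonal fst (rem f (enum_fset L)).
have [e [m [g g0 [e0E em]]]] := primitive_multiple e00.
have en0 : e != 0 by apply: contra e00 => /eqP e_0; rewrite e0E e_0 scaler0.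
have orth h : h \in L -> h != f -> idot h.1 e = 0.
  move=> hL hf; apply: (mulfI g0); rewrite mulr0 -idotZr -e0E; apply: e0L.
  by rewrite (mem_rem_uniq _ (fset_uniq L)) inE hf.
exists e => // y yd; apply/eqP => /cexpi_eq1[j yj]; apply: yd.
exists f.
  split; last by rewrite /= !inE /= fL kf.
  (* [Ltilde] removes every copy of the vector [f.1]. What is left comes from members other than
     [f], all orthogonal to the nonzero [e], so the rank is not [r]. *)
  split => // hZ; case/eqP: en0; apply: (Zrank_orthogonal0 hZ) => a.
  rewrite !inE => /andP[af /imfsetP[h /= hL ah]]; rewrite ah; apply: orth => //.
  by apply: contra af => /eqP <-; rewrite ah.
exists (y - ofZ R (j *: m)); last first.
  by exists (j *: m) => //; rewrite subrK.
apply: (mem_hyp_orthogonal sL en0 orth).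
have -> : dot (y - ofZ R (j *: m)) (ofZ R e) =
    dot y (ofZ R e) - dot (ofZ R (j *: m)) (ofZ R e).
  by rewrite /dot -sumrB; apply: eq_bigr => l _; rewrite !mxE mulrBl.
rewrite yj dot_ofZ -rmorphB /= (_ : idot (j *: m) e = j) ?subrr //.
rewrite -[RHS]mulr1 -em /idot mulr_sumr; apply: eq_bigr => l _.
by rewrite mxE; ring.
Qed.

Lemma fevalE (f : func) (v : 'rV[int]_r) :
  feval f (ofZ R v) = (idot f.1 v)%:~R + f.2.
Proof. by rewrite /feval dot_ofZ rmorph_int. Qed.

Lemma fprod_phi_box (N : R) (L : {fset func}) (k : func -> nat) (v : 'rV[int]_r) :
  box N L k v -> fprod (enum_fset L) (phi k) v =
    \prod_(f <- enum_fset (Lplus L k)) (feval f (ofZ R v) ^+ k f)^-1.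
Proof.
move=> [_ _ v0]; rewrite /fprod (bigID (fun f => (0 < k f)%N)) /=.
rewrite [X in _ * X]big1_seq ?mulr1 => [|f /andP[kf fL]]; last first.
  have kf0 : k f = 0%N by move: kf; rewrite lt0n negbK => /eqP.
  by rewrite /phi kf0 eqxx -fevalE v0 ?eqxx // !inE /= fL kf0.
rewrite -big_filter; transitivity (\prod_(f <- enum_fset (Lplus L k)) phi k f (idot f.1 v)).
  apply: perm_big; apply: uniq_perm; rewrite ?filter_uniq ?fset_uniq //.
  by move=> f; rewrite mem_filter !inE /= andbC.
rewrite big_seq [RHS]big_seq; apply: eq_bigr => f.
by rewrite !inE /= => /andP[_ kf]; rewrite /phi gtn_eqF // fevalE.
Qed.

(** A violated condition makes a factor vanish: through [0^-1 = 0] if [0 < k f], through the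
    indicator if [k f = 0]. *)
Lemma fprod_phi_notbox (N : R) (L : {fset func}) (k : func -> nat) (v : 'rV[int]_r) :
  (forall j, `|(v 0 j)%:~R : R| <= N) -> ~ box N L k v ->
  fprod (enum_fset L) (phi k) v = 0.
Proof.
move=> vN nb; apply/eqP/negPn/negP => F0; apply: nb; split => // f.
  rewrite !inE /= => /andP[fL kf]; apply: contra F0 => /eqP f0.
  rewrite /fprod prodf_seq_eq0; apply/hasP; exists f => //=.
  by rewrite /phi gtn_eqF // -fevalE f0 expr0n gtn_eqF // invr0.
rewrite !inE /= => /andP[fL /eqP kf]; apply/eqP; move: F0; apply: contraNT => f0.
rewrite /fprod prodf_seq_eq0; apply/hasP; exists f => //=.
by rewrite /phi kf eqxx -fevalE (negbTE f0).
Qed.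

(** The conditions of [box] are carried by the factors, so the sum extends by zero to the whole
    cube; as coordinates are integers, the real bound [N] may be truncated. *)
Lemma Zsum_Tsum (N : R) (k : func -> nat) (y : 'rV[R]_r) (L : {fset func}) :
  0 <= N -> Zsum N k y L =
  (-1) ^+ #|` Lk L k 0| * Tsum (enum_fset L) (phi k) (Num.truncn N) y.
Proof.
move=> N0; rewrite /Zsum; congr (_ * _).
have cubeP v : v \in cube r (Num.truncn N) <-> forall j, `|(v 0 j)%:~R : R| <= N.
  have vE j : (absz (v 0%R j) <= Num.truncn N)%N = (`|(v 0 j)%:~R : R| <= N).
    by rewrite truncn_ge_nat // -intr_norm -abszE.
  rewrite mem_cube; split => [/forallP vN j|vN]; first by rewrite -vE.
  by apply/forallP => j; rewrite vE.
transitivity (\sum_(v \in box N L k) (echar y v * fprod (enum_fset L) (phi k) v)).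
  by apply: eq_fsbigr => v; rewrite inE => vb; rewrite (fprod_phi_box vb).
rewrite (fsbig_widen (box N L k) [set` cube r (Num.truncn N)]).
- by rewrite -fsbig_seq ?cube_uniq.
- by move=> v [vN _ _]; exact/cubeP.
- move=> v [/= /cubeP vN nb]; by rewrite (fprod_phi_notbox vN nb) mulr0.
Qed.

End Coloops.

(** * Limits and continuity of complex-valued functions *)

Section ComplexLimits.
Variable R : realType.

(** Positive elements of [R[i]] are real, so the complex radii in the topology of [R[i]^o] reduce to
    real ones. *)
Lemma cvg_cmodP (T : Type) (F : set_system T) {FF : Filter F} (g : T -> R[i]^o)
    (l : R[i]^o) :
  g @ F --> l <->
  (forall e : R, 0 < e -> \forall t \near F, cmod (l - g t : R[i]) < e).
Proof.
split => [/cvgrPdist_lt gl e e0|gl].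
  have e0' : 0 < e%:C :> R[i] by rewrite ltcR.
  by apply: filterS (gl _ e0') => t; rewrite -ltcR cmodE.
apply/cvgrPdist_lt => e e0.
have eE : (complex.Re e)%:C = e by rewrite RRe_real // gtr0_real.
have e0' : 0 < complex.Re e by rewrite -ltcR eE.
by apply: filterS (gl _ e0') => t; rewrite -ltcR cmodE eE.
Qed.

(** The intervals of radius [d n] around [u n] meet pairwise, so the supremum of their left ends
    lies in all of them, which keeps the rate [d] without loss. *)
Lemma real_cauchy_rate (u d : nat -> R) :
  (forall n m, (n <= m)%N -> `|u m - u n| <= d n) ->
  exists l : R, forall n, `|l - u n| <= d n.
Proof.
move=> ud; pose E := [set u n - d n | n in [set: nat]].
have ub n m : u n - d n <= u m + d m.
  have := ud n (maxn n m) (leq_maxl n m); have := ud m (maxn n m) (leq_maxr n m).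
  by rewrite !ler_norml => /andP[a1 a2] /andP[b1 b2]; lra.
have E0 : E !=set0 by exists (u 0%N - d 0%N); exists 0%N.
have Eub m : ubound E (u m + d m) by move=> _ [n _ <-]; exact: ub.
exists (sup E) => n; rewrite ler_norml.
have h1 : u n - d n <= sup E.
  by apply: ub_le_sup; [exists (u 0%N + d 0%N)|exists n].
have h2 : sup E <= u n + d n by apply: ge_sup.
by apply/andP; split; lra.
Qed.

Lemma ler_cmod_ReIm (z : R[i]) : cmod z <= `|complex.Re z| + `|complex.Im z|.
Proof.
rewrite /cmod normc_def /= -[leRHS]ger0_norm ?addr_ge0 // -sqrtr_sqr.
rewrite ler_sqrt ?sqr_ge0 // sqrrD !real_normK ?num_real //.
by rewrite lerD2r lerDl mulrn_wge0 // mulr_ge0.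
Qed.

Lemma Re_le_cmod (z : R[i]) : `|complex.Re z| <= cmod z.
Proof. by rewrite -lecR cmodE normc_ge_Re. Qed.

Lemma Im_le_cmod (z : R[i]) : `|complex.Im z| <= cmod z.
Proof.
rewrite /cmod normc_def /= -sqrtr_sqr ler_sqrt ?addr_ge0 ?sqr_ge0 //.
by rewrite lerDr sqr_ge0.
Qed.

(** The factor [2] comes from treating real and imaginary parts separately. *)
Lemma complex_cauchy_rate (u : nat -> R[i]) (d : nat -> R) :
  (forall n m, (n <= m)%N -> cmod (u m - u n) <= d n) ->
  exists l : R[i], forall n, cmod (l - u n) <= 2 * d n.
Proof.
move=> ud.
have ReB (z w : R[i]) : complex.Re (z - w) = complex.Re z - complex.Re w.
  by case: z => a b; case: w.
have ImB (z w : R[i]) : complex.Im (z - w) = complex.Im z - complex.Im w.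
  by case: z => a b; case: w.
have [n m nm|a aP] := @real_cauchy_rate (fun n => complex.Re (u n)) d.
  by rewrite -ReB; apply: le_trans (ud _ _ nm); exact: Re_le_cmod.
have [n m nm|b bP] := @real_cauchy_rate (fun n => complex.Im (u n)) d.
  by rewrite -ImB; apply: le_trans (ud _ _ nm); exact: Im_le_cmod.
exists (a +i* b) => n; apply: (le_trans (ler_cmod_ReIm _)).
by rewrite ReB ImB /= mulr_natl mulr2n lerD.
Qed.

Lemma cvg_complex (T : Type) (F : set_system T) {FF : Filter F} (a b : T -> R)
    (la lb : R) : a @ F --> la -> b @ F --> lb ->
  ((a t +i* b t : R[i]^o) @[t --> F]) --> (la +i* lb : R[i]^o).
Proof.
move=> /cvgrPdist_lt ca /cvgrPdist_lt cb; apply/cvg_cmodP => e e0.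
have e2 : 0 < e / 2 by rewrite divr_gt0.
near=> t; apply: (le_lt_trans (ler_cmod_ReIm _)) => /=.
have h1 : `|la - a t| < e / 2 by near: t; exact: ca.
have h2 : `|lb - b t| < e / 2 by near: t; exact: cb.
by rewrite [ltRHS]splitr ltrD.
Unshelve. all: by end_near. Qed.

Lemma continuous_uniform_limit (T : topologicalType) (U : nat -> T -> R[i]^o)
    (g : T -> R[i]^o) (d : nat -> R) :
  (forall n, continuous (U n)) -> d @ \oo --> (0 : R) ->
  (forall n y, cmod (g y - U n y : R[i]) <= d n) -> continuous g.
Proof.
move=> Uc d0 gU y; apply/cvg_cmodP => e e0.
have e3 : 0 < e / 3 by rewrite divr_gt0.
have [n dn] : exists n, d n < e / 3.
  move/cvgrPdist_lt : d0 => /(_ _ e3)[n _ nP]; exists n.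
  have := nP n (leqnn n); rewrite /= sub0r normrN; exact: le_lt_trans (ler_norm _).
have /cvg_cmodP /(_ _ e3) Un := Uc n y.
apply: filterS Un => z Uz.
have -> : (g y - g z : R[i]) = (g y - U n y) + (U n y - U n z) - (g z - U n z) by ring.
apply: (le_lt_trans (ler_cmodB _ _)).
have h1 := ler_cmodD (g y - U n y : R[i]) (U n y - U n z).
have h2 := gU n y; have h3 := gU n z.
move: Uz h1 h2 h3; move: (cmod _) (cmod _) (cmod _) (cmod _) => *; lra.
Qed.

Variable r : nat.

Lemma continuous_echar (v : 'rV[int]_r) :
  continuous (fun y : 'rV[R]_r => echar y v : R[i]^o).
Proof.
have dc : continuous (fun y : 'rV[R]_r => dot y (ofZ R v)).
  move=> y; rewrite /dot; elim: (index_enum _) => [|j t IHt].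
    under eq_fun do rewrite big_nil.
    exact: (@cst_continuous _ R).
  under eq_fun do rewrite big_cons.
  have h1 : {for y, continuous (fun z : 'rV[R]_r => z 0 j)}.
    exact: coord_continuous.
  have h2 := @cst_continuous _ R (ofZ R v 0 j) y.
  exact: (cvgD (cvgM h1 h2) IHt).
have dc2 : continuous (fun y : 'rV[R]_r => 2 * pi * dot y (ofZ R v)).
  by move=> y; exact: (cvgM (@cst_continuous _ R (2 * pi) y) (dc y)).
move=> y; rewrite /echar.
have -> : (fun y : 'rV[R]_r => cexpi (2 * pi * dot y (ofZ R v))) =
    (fun y => cos (2 * pi * dot y (ofZ R v)) +i* sin (2 * pi * dot y (ofZ R v))).
  by apply/funext => z; rewrite cexpiE.
apply: (@cvg_complex _ (nbhs y)).
  exact: (continuous_comp (dc2 y) (@continuous_cos R _)).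
exact: (continuous_comp (dc2 y) (@continuous_sin R _)).
Qed.

Lemma cvg_mulC (T : Type) (F : set_system T) {FF : Filter F}
    (f g : T -> R[i]^o) (a b : R[i]^o) : f @ F --> a -> g @ F --> b ->
  (f t * g t : R[i]^o) @[t --> F] --> (a * b : R[i]^o).
Proof. exact: (@cvgM R[i]). Qed.

Lemma cvg_invC (T : Type) (F : set_system T) {FF : Filter F}
    (f : T -> R[i]^o) (a : R[i]^o) : (a : R[i]) != 0 -> f @ F --> a ->
  ((f t : R[i])^-1 : R[i]^o) @[t --> F] --> ((a : R[i])^-1 : R[i]^o).
Proof. exact: (@cvgV R[i]). Qed.

Lemma continuous_Tsum (s : seq ('rV[int]_r * R[i])) psi (n : nat) :
  continuous (fun y : 'rV[R]_r => Tsum s psi n y : R[i]^o).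
Proof.
move=> y; rewrite /Tsum; elim: (cube r n) => [|v t IHt].
  under eq_fun do rewrite big_nil.
  exact: (@cst_continuous _ R[i]^o).
under eq_fun do rewrite big_cons.
have h := @cst_continuous _ R[i]^o (fprod s psi v) y.
exact: (cvgD (cvg_mulC (@continuous_echar v y) h) IHt).
Qed.

Lemma continuous_prod_echar (I : Type) (s : seq I) (e : I -> 'rV[int]_r) :
  continuous (fun y : 'rV[R]_r => \prod_(c <- s) (1 - echar y (e c)) : R[i]^o).
Proof.
move=> y; elim: s => [|c s IHs].
  under eq_fun do rewrite big_nil.
  exact: (@cst_continuous _ R[i]^o).
under eq_fun do rewrite big_cons.
have h := @cst_continuous _ R[i]^o (1 : R[i]) y.
exact: (cvg_mulC (cvgB h (@continuous_echar (e c) y)) IHs).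
Qed.

End ComplexLimits.

(** * Convergence and continuity on the domain *)

Theorem theorem2p2 (R : realType) (r : nat) (hr : (1 <= r)%N)
    (L : {fset ('rV[int]_r * R[i])%type})
    (hL0 : forall f, f \in L -> f.1 != 0)
    (hLr : Zrank (Zspan (vecs L)) r)
    (k : 'rV[int]_r * R[i] -> nat) :
  (forall y : 'rV[R]_r, ydom L k y -> cvg (Zsum N k y L @[N --> +oo%R])) /\
  {within ydom L k, continuous (fun y : 'rV[R]_r => Slim k y L)}.
Proof.
set s := enum_fset L.
have us : uniq s := fset_uniq L.
have sp : spans s := spans_full hLr.
(* These are the functionals of exponent one that occur in every basis taken from [L]; summation by
   parts is applied to each of them. *)
pose cs := [seq f <- s | (k f == 1%N) && `[< ~ spans (rem f s) >]].
have csP f : f \in cs -> [/\ f \in L, k f = 1%N & ~ spans (rem f s)].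
  by rewrite mem_filter => /andP[/andP[/eqP kf /asboolP nsp] fL].
have ucs : uniq cs by rewrite filter_uniq.
have css : {subset cs <= s} by move=> f /csP[].
have k1 c : c \in cs -> k c = 1%N by move=> /csP[].
have /choice[e eP] : forall f, exists e : 'rV[int]_r, f \in cs ->
    (forall g, g \in L -> g != f -> idot g.1 e = 0) /\
    forall y, ydom L k y -> echar y e != 1.
  move=> f; have [/csP[fL kf nsp]|_] := boolP (f \in cs); last by exists 0.
  by have [e e1 e2] := coloop_direction sp fL kf nsp; exists e.
have orth c f : c \in cs -> f \in s -> f != c -> idot f.1 (e c) = 0.
  by move=> /eP[oc _]; exact: oc.
have kps f : f \in s -> kaps k cs f = 2%N \/ spans (rem f s).
  move=> fs; have [spf|nsp] := pselect (spans (rem f s)); first by right.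
  left; rewrite /kaps /kap mem_filter fs andbT.
  by case: (k f == 1%N) => //=; rewrite asboolT.
have [d d0 dP] := Tsum_uniform_cauchy hr us sp ucs css k1 orth kps.
pose P (y : 'rV[R]_r) : R[i] := \prod_(c <- cs) (1 - echar y (e c)).
have P0 y : ydom L k y -> P y != 0.
  move=> yd; rewrite /P prodf_seq_neq0; apply/allP => c /eP[_ ec].
  by rewrite /= subr_eq0 eq_sym ec.
(* [Phi] is defined on all of [V], including the zeros of [P]; division by [P] comes only
   afterwards. *)
have /choice[Phi PhiP] : forall y, exists l : R[i], forall n,
    cmod (l - P y * Tsum s (phi k) n y) <= 2 * d n.
  by move=> y; apply: complex_cauchy_rate => n m; exact: dP.
have dd0 : (2 * d n) @[n --> \oo] --> (0 : R).
  by rewrite -[X in _ --> X](mulr0 2); apply: cvgMr.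
have Pc : continuous (P : 'rV[R]_r -> R[i]^o) by exact: continuous_prod_echar.
have Phic : continuous (Phi : 'rV[R]_r -> R[i]^o).
  apply: (continuous_uniform_limit _ dd0 (fun n y => PhiP y n)) => n y.
  exact: (cvg_mulC (Pc y) (@continuous_Tsum R r s (phi k) n y)).
pose sg : R[i] := (-1) ^+ #|` Lk L k 0|.
pose S (y : 'rV[R]_r) : R[i]^o := sg * (Phi y * (P y)^-1).
have sg1 : cmod sg = 1 by rewrite cmodX cmodN cmod1 expr1n.
have ZS y : ydom L k y -> Zsum N k y L @[N --> +oo%R] --> S y.
  move=> yd; apply/cvg_cmodP => eps eps0.
  have q0 : 0 < cmod (P y) by rewrite lt_def cmod_eq0 P0 //= cmod_ge0.
  (* The tolerance is scaled by [cmod (P y)] to make up for the later division by [P y]. *)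
  have eq0 : 0 < eps * cmod (P y) by rewrite mulr_gt0.
  move/cvgrPdist_lt : dd0 => /(_ _ eq0)[n0 _ n0P].
  near=> N.
  have N0 : n0%:R <= N by near: N; apply: nbhs_pinfty_ge; rewrite num_real.
  have Nge0 : 0 <= N by apply: le_trans N0; rewrite ler0n.
  have nN : (n0 <= Num.truncn N)%N by rewrite truncn_ge_nat.
  rewrite Zsum_Tsum // /S -mulrBr cmodM sg1 mul1r.
  set T := Tsum _ _ _ _.
  have -> : Phi y * (P y)^-1 - T = (Phi y - P y * T) * (P y)^-1.
    by rewrite mulrBl mulrAC mulfV ?mul1r // P0.
  rewrite cmodM cmodV ltr_pdivrMr //; apply: (le_lt_trans (PhiP y _)).
  have := n0P _ nN; rewrite /= sub0r normrN; exact: le_lt_trans (ler_norm _).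
split=> [y yd|]; first by apply/cvg_ex; exists (S y); exact: ZS.
(* [Slim] is identified with [S] only on the domain, which is enough for continuity within it; [S]
   is continuous at its points because [P] does not vanish there. *)
have SlimE y : ydom L k y -> Slim k y L = S y.
  by move=> yd; apply: cvg_lim; [exact: norm_hausdorff|exact: ZS].
apply/subspace_continuousP => y yd.
have Sc : S @ y --> S y.
  have h := @cst_continuous _ R[i]^o sg y.
  exact: (cvg_mulC h (cvg_mulC (Phic y) (cvg_invC (P0 y yd) (Pc y)))).
apply/cvg_cmodP => eps eps0; rewrite near_withinE.
move/cvg_cmodP : Sc => /(_ _ eps0); apply: filterS => z Sz zd.
by rewrite /from_subspace /= !SlimE.
Unshelve. all: by end_near. Qed.
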